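(* Let $K\subset S^3$ be a knot. There is a spectral sequence $E_k(-1)$ (the one constructed in the context) which starts at the reduced HOMFLY homology $\overline{H}(K)$ (i.e. $E_2(-1)\cong\overline{H}(K)$) and converges to $\mathbb{Q}$.
   Context: Tangle diagrams. A tangle diagram $D$ is an oriented planar graph all of whose vertices have valence 1 (free ends), 2 (marks: one incoming, one outgoing edge) or 4 (crossings: two incoming, two outgoing edges), each crossing being decorated as positive, negative or singular. $D$ is closed if it has no free ends. At a crossing the incoming edges are labelled $i,j$ and the outgoing edges $k,l$ so that the oriented resolution joins $i$ to $k$ and $j$ to $l$ (at an ordinary crossing the two strands run from $j$ to $k$ and from $i$ to $l$). The edge ring is $R(D)=\mathbb{Q}[X_e: e \text{ an edge}]/(\rho(v))$, $v$ running over all 2- and 4-valent vertices, where $\rho(v)$ is the sum of the variables of the outgoing edges at $v$ minus the sum of the variables of the incoming edges; it is graded by $q(X_e)=2$. The reduced ring $R_r(D)\subset R(D)$ is the subring generated by all differences $X_e-X_{e'}$. Double complex. Let $D$ be a connected diagram (only positive and negative crossings) which is the closure of a braid with $b$ strands and writhe $w$, representing the link $L$. Write $R=R_r(D)$; $R\{a,b,c\}$ is a free rank one module with generator in triple degree $(q,2\mathrm{gr}_h,2\mathrm{gr}_v)=(a,b,c)$, and in general $M\{a,b,c\}$ is $M$ with all degrees raised by $(a,b,c)$. To each crossing assign a free module with maps $d_+,d_v$ (components not listed are $0$): Positive: $A=R\{2,-2,-2\}$, $B=R\{0,0,-2\}$, $A'=R\{0,-2,0\}$, $B'=R\{0,0,0\}$;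 $d_+$: $A\to B$ by $-(X_k-X_i)(X_k-X_j)$, $A'\to B'$ by $X_k-X_i$; $d_v$: $A\to A'$ by $X_j-X_k$, $B\to B'$ by $1$. Negative: $A=R\{0,-2,0\}$, $B=R\{0,0,0\}$, $A'=R\{0,-2,2\}$, $B'=R\{-2,0,2\}$; $d_+$: $A\to B$ by $X_k-X_i$, $A'\to B'$ by $-(X_k-X_i)(X_k-X_j)$; $d_v$: $A\to A'$ by $1$, $B\to B'$ by $X_j-X_k$. $C_r(D)$ is the tensor product over $R_r(D)$ of these factors over all crossings ($C_r(D)=R_r(D)$ if there are none), with $d_+$, $d_v$ the tensor product differentials with signs arranged so that $d_+d_v+d_vd_+=0$. $d_+$ raises $\mathrm{gr}_h$ by $1$ and preserves $\mathrm{gr}_v$; $d_v$ raises $\mathrm{gr}_v$ by $1$ and preserves $\mathrm{gr}_h$. Reduced HOMFLY homology. $\overline{H}(L)=H(H(C_r(D),d_+),d_v^* )\{-w+b-1,w+b-1,w-b+1\}$, triply graded by $(i,j,k)=(q,2\mathrm{gr}_h,2\mathrm{gr}_v)$, where $d_v^*$ is the map induced by $d_v$. It is independent of $D$ up to isomorphism (Khovanov–Rozansky). Spectral sequence. $E_k(-1)$ is the spectral sequence of the total complex $(C_r(D),d_++d_v)$ for which $d_0=d_+$ and $d_1=d_v^*$, i.e. the one induced by the filtration by $\mathrm{gr}_v$, with triple grading shifted by $\{-w+b-1,w+b-1,w-b+1\}$. *)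

(* Defs.v *)
From HB Require Import structures.
From mathcomp Require Import all_boot all_order all_algebra.
From mathcomp Require Import mpoly.
From mathcomp Require Import boolp.
Set Implicit Arguments. Unset Strict Implicit. Unset Printing Implicit Defensive.
Import Order.TTheory GRing.Theory Num.Theory.
Local Open Scope quotient_scope.
Local Open Scope ring_scope.

Record submod (V : lmodType rat) := Submod {
  in_submod :> V -> Prop;
  submod0 : in_submod 0;
  submodZD : forall a x y, in_submod x -> in_submod y -> in_submod (a *: x + y)
}.

Lemma submodZ (V : lmodType rat) (S : submod V) a x : S x -> S (a *: x).
Proof. by move=> Sx; rewrite -[_ *: _]addr0; apply: submodZD => //; exact: submod0. Qed.

(* subquo Z B is the quotient Z / (B \cap Z). *)
Section Subquotient.
Variables (V : lmodType rat) (Z B : submod V).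

Definition submod_mem : {pred V} := fun x => `[< Z x >].

Lemma submod_mem_closed : submod_closed submod_mem.
Proof.
split=> [|a x y]; rewrite !unfold_in; first by apply/asboolP; exact: submod0.
by move=> /asboolP hx /asboolP hy; apply/asboolP; exact: submodZD.
Qed.
HB.instance Definition _ := GRing.isSubmodClosed.Build rat V submod_mem
  submod_mem_closed.

Record submod_elt := SubmodElt {
  submod_val : V; submod_valP : submod_val \in submod_mem }.
HB.instance Definition _ := [isSub for submod_val].
HB.instance Definition _ := [Choice of submod_elt by <:].
HB.instance Definition _ := [SubChoice_isSubLmodule of submod_elt by <:].

Let submod_valB x y : submod_val (x - y) = submod_val x - submod_val y.
Proof. exact: (raddfB (\val : submod_elt -> V)). Qed.
Let submod_valD x y : submod_val (x + y) = submod_val x + submod_val y.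
Proof. exact: (raddfD (\val : submod_elt -> V)). Qed.
Let submod_valZ a x : submod_val (a *: x) = a *: submod_val x.
Proof. exact: (linearZ_LR (\val : submod_elt -> V)). Qed.

Definition denom : {pred submod_elt} := fun x => `[< B (submod_val x) >].

Lemma denom_closed : submod_closed denom.
Proof.
split=> [|a x y]; rewrite !unfold_in.
  by apply/asboolP; rewrite -(subrr (0 : submod_elt)) submod_valB subrr; exact: submod0.
move=> /asboolP hx /asboolP hy; apply/asboolP.
have -> : submod_val (a *: x + y) = a *: submod_val x + submod_val y.
  by rewrite -submod_valZ -submod_valD.
exact: submodZD.
Qed.
HB.instance Definition _ := GRing.isSubmodClosed.Build rat submod_elt denom
  denom_closed.

Definition subquo : Type := (Quotient.quot denom).
HB.instance Definition _ := Choice.on subquo.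
HB.instance Definition _ := GRing.Zmodule.on subquo.

Definition subquo_pi (x : submod_elt) : subquo := \pi_(Quotient.quot denom) x.

Lemma subquo_pi_is_zmod : zmod_morphism subquo_pi.
Proof. exact: (@raddfB _ _ \pi_(Quotient.quot denom)). Qed.



HB.instance Definition _ :=
  GRing.isZmodMorphism.Build submod_elt subquo subquo_pi subquo_pi_is_zmod.

Lemma subquo_piE x y : subquo_pi x = subquo_pi y <-> B (submod_val x - submod_val y).
Proof.
split=> [/eqP|Bxy].
  by rewrite -(Quotient.idealrBE denom) => /asboolP; rewrite submod_valB.
by apply/eqP; rewrite -(Quotient.idealrBE denom); apply/asboolP; rewrite submod_valB.
Qed.

Definition subquo_scale (a : rat) (u : subquo) : subquo :=
  subquo_pi (a *: repr u).

Lemma subquo_pi_repr u : subquo_pi (repr u) = u.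
Proof. exact: reprK. Qed.

Lemma subquo_scale_pi a x : subquo_scale a (subquo_pi x) = subquo_pi (a *: x).
Proof.
apply/subquo_piE; rewrite !submod_valZ -scalerBr.
by apply: submodZ; apply/subquo_piE; rewrite subquo_pi_repr.
Qed.

Lemma subquo_scaleA a b u :
  subquo_scale a (subquo_scale b u) = subquo_scale (a * b) u.
Proof. by rewrite subquo_scale_pi scalerA. Qed.
Lemma subquo_scale1 : left_id 1 subquo_scale.
Proof. by move=> u; rewrite /subquo_scale scale1r subquo_pi_repr. Qed.
Lemma subquo_scaleDr : right_distributive subquo_scale +%R.
Proof.
move=> a u v; rewrite -[u]subquo_pi_repr -[v]subquo_pi_repr -raddfD.
by rewrite !subquo_scale_pi scalerDr raddfD.
Qed.
Lemma subquo_scaleDl u : {morph subquo_scale^~ u : a b / a + b}.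
Proof. by move=> a b; rewrite /subquo_scale scalerDl raddfD. Qed.

HB.instance Definition _ := GRing.Zmodule_isLmodule.Build rat subquo
  subquo_scaleA subquo_scale1 subquo_scaleDr subquo_scaleDl.

(* The class in Z/B of a vector of Z; a vector outside Z is sent to 0. *)
Definition cls (x : V) : subquo := subquo_pi (insubd 0 x).

Definition rep (u : subquo) : V := submod_val (repr u).

Lemma repP u : Z (rep u). Proof. exact/asboolP/(submod_valP (repr u)). Qed.

Lemma repK u : cls (rep u) = u.
Proof. by rewrite /cls /rep valKd subquo_pi_repr. Qed.

Lemma clsP x y : Z x -> Z y -> (cls x = cls y <-> B (x - y)).
Proof.
move=> Zx Zy; rewrite /cls subquo_piE !val_insubd !unfold_in.
by rewrite (asboolT Zx) (asboolT Zy).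
Qed.

Lemma clsZD a x y : Z x -> Z y -> cls (a *: x + y) = a *: cls x + cls y.
Proof.
move=> Zx Zy.
transitivity (subquo_pi (a *: (insubd 0 x : submod_elt) + insubd 0 y)).
  apply/subquo_piE; rewrite submod_valD submod_valZ !val_insubd !unfold_in.
  rewrite (asboolT Zx) (asboolT Zy) (asboolT (submodZD a Zx Zy)) subrr.
  exact: submod0.
by rewrite raddfD; congr (_ + _); exact/esym/subquo_scale_pi.
Qed.

Lemma cls0 : cls 0 = 0.
Proof.
have Z0 := submod0 Z; have := clsZD (-1) Z0 Z0.
by rewrite !scaleN1r oppr0 addr0 addNr.
Qed.

End Subquotient.

Lemma zero_submodZD (V : lmodType rat) a (x y : V) :
  x = 0 -> y = 0 -> a *: x + y = 0.
Proof. by move=> -> ->; rewrite scaler0 addr0. Qed.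
Definition zero_submod (V : lmodType rat) : submod V :=
  @Submod V (fun x => x = 0) (erefl 0) (@zero_submodZD V).

(* Triply graded rational vector spaces.  Degrees are (q, 2gr_h, 2gr_v);
   has_deg a b c is the subspace of homogeneous elements of degree (a, b, c). *)
Record gmod := Gmod {
  gmod_sort :> lmodType rat;
  has_deg : int -> int -> int -> gmod_sort -> Prop
}.

(* M{a,b,c}: all degrees are raised by (a, b, c). *)
Definition gshift (M : gmod) (a b c : int) : gmod :=
  Gmod (fun a' b' c' (x : M) => has_deg (a' - a) (b' - b) (c' - c) x).

Definition lin_iso (V W : lmodType rat) : Prop :=
  exists f : {linear V -> W}, bijective f.

Definition giso (M N : gmod) : Prop :=
  exists2 f : {linear M -> N}, bijective f &
    forall a b c x, has_deg a b c x <-> has_deg a b c (f x).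

Definition dgiso (M N : gmod) (d : M -> M) (e : N -> N) : Prop :=
  exists2 f : {linear M -> N}, bijective f &
    (forall a b c x, has_deg a b c x <-> has_deg a b c (f x)) /\
    (forall x, f (d x) = e (f x)).

Section Homology.
Variables (M : gmod) (d : {linear M -> M}).

Lemma cycles_closed a x y : d x = 0 -> d y = 0 -> d (a *: x + y) = 0.
Proof. by move=> dx dy; rewrite linearP dx dy scaler0 addr0. Qed.
Definition cycles : submod M :=
  @Submod M (fun x => d x = 0) (linear0 d) cycles_closed.

Lemma boundaries0 : exists y, 0 = d y.
Proof. by exists 0; rewrite linear0. Qed.
Lemma boundaries_closed a x y :
  (exists x', x = d x') -> (exists y', y = d y') ->
  exists z, a *: x + y = d z.
Proof. by move=> [x' ->] [y' ->]; exists (a *: x' + y'); rewrite linearP. Qed.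
Definition boundaries : submod M :=
  @Submod M (fun x => exists y, x = d y) boundaries0 boundaries_closed.

Definition homology : gmod :=
  @Gmod (subquo cycles boundaries) (fun a b c u =>
    exists x, [/\ d x = 0, has_deg a b c x & u = cls cycles boundaries x]).

(* The endomorphism [x] |-> [e x] of homology, for e anticommuting with d. *)
Variables (e : {linear M -> M}) (de : forall x, d (e x) + e (d x) = 0).

Definition induced (u : homology) : homology :=
  cls cycles boundaries (e (rep u)).

Lemma induced_cycle x : d x = 0 -> d (e x) = 0.
Proof. by move=> dx; have := de x; rewrite dx linear0 addr0. Qed.

Lemma induced_is_linear : linear induced.
Proof.
move=> a u v; have Zr (w : homology) := induced_cycle (repP w).
rewrite /induced -clsZD; [|exact: Zr..].
have ZZ := cycles_closed a (Zr u) (Zr v).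
apply/clsP; [exact: Zr|exact: ZZ|rewrite -linearP -linearB /=].
have : boundaries (rep (a *: u + v) - (a *: rep u + rep v)).
  apply/(clsP _ (repP _)); first exact: (cycles_closed a (repP u) (repP v)).
  by rewrite clsZD ?repK //; exact: repP.
move=> [y ->]; exists (- e y).
by rewrite linearN; apply/eqP; rewrite -addr_eq0 addrC de.
Qed.

Definition induced_linear : {linear homology -> homology} :=
  HB.pack induced
    (GRing.isLinear.Build rat homology homology _ induced induced_is_linear).

End Homology.
(* A double complex whose underlying space is free over coef on the finite set
   gen; the generator i sits in degree (gr_q i, 2 gr_h i, 2 gr_v i). *)
Record bicomplex := Bicomplex {
  gen : finType;
  coef : lmodType rat;
  has_qdeg : int -> coef -> Prop;
  gr_q : gen -> int;
  gr_h : gen -> int;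
  gr_v : gen -> int;
  d_plus : {linear {ffun gen -> coef} -> {ffun gen -> coef}};
  d_vert : {linear {ffun gen -> coef} -> {ffun gen -> coef}};
  d_plusK : forall x, d_plus (d_plus x) = 0;
  d_vertK : forall x, d_vert (d_vert x) = 0;
  d_plus_vert : forall x, d_plus (d_vert x) + d_vert (d_plus x) = 0
}.

Section SpectralSequence.
Variable C : bicomplex.

Definition chains : gmod :=
  @Gmod {ffun gen C -> coef C} (fun a b c x => forall i : gen C, x i != 0 ->
    [/\ has_qdeg (a - gr_q i) (x i), b = 2 * gr_h i & c = 2 * gr_v i]).

Definition dp : {linear chains -> chains} := @d_plus C.
Definition dv : {linear chains -> chains} := @d_vert C.
Definition dtot : {linear chains -> chains} := @d_plus C \+ @d_vert C.

Lemma dtotK x : dtot (dtot x) = 0.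
Proof.
rewrite /= !linearD /= d_plusK d_vertK add0r addr0.
exact: d_plus_vert.
Qed.

Definition H_plus : gmod := homology dp.
Definition d_vert_star : {linear H_plus -> H_plus} :=
  induced_linear (d_plus_vert (b := C) : forall x, dp (dv x) + dv (dp x) = 0).
(* H(H(C, d_+), d_v^* ) *)
Definition H_vert : gmod := homology d_vert_star.

(* The filtration by gr_v is F^p = filt p; it is decreasing and split, and its
   associated graded is C itself.  agree p x y: x = y in F^p / F^(p+1). *)
Local Notation v := (@gr_v C).

Definition filt (p : int) (x : chains) : Prop :=
  forall i : gen C, v i < p -> x i = 0.
Definition agree (p : int) (x y : chains) : Prop :=
  forall i : gen C, v i = p -> x i = y i.

Lemma filt0 p : filt p 0. Proof. by move=> i _; rewrite ffunE. Qed.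
Lemma filtZD p a x y : filt p x -> filt p y -> filt p (a *: x + y).
Proof. by move=> hx hy i hi; rewrite !ffunE hx // hy // scaler0 addr0. Qed.
Lemma agreeZD p a x x' y y' :
  agree p x x' -> agree p y y' -> agree p (a *: x + y) (a *: x' + y').
Proof. by move=> hx hy i hi; rewrite !ffunE hx // hy. Qed.

Section Page.
Variable k : nat.

(* With Z_k^p = {y in F^p | dy in F^(p+k)}, the term
     E_k^p = Z_k^p / (Z_(k-1)^(p+1) + d Z_(k-1)^(p-k+1))
   is identified with the quotient of the images of Z_k^p and of
   d Z_(k-1)^(p-k+1) in F^p / F^(p+1); in_Z and in_B are the direct sums over p
   of these images, inside the associated graded C. *)
Definition in_Z (x : chains) : Prop := forall p, exists y : chains,
  [/\ filt p y, filt (p + k%:Z) (dtot y) & agree p y x].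
Definition in_B (x : chains) : Prop := forall p, exists y : chains,
  [/\ filt (p - k%:Z + 1) y, filt p (dtot y) & agree p (dtot y) x].

Lemma in_Z0 : in_Z 0.
Proof. by move=> p; exists 0; split=> //; rewrite ?linear0; exact: filt0. Qed.
Lemma in_ZZD a x y : in_Z x -> in_Z y -> in_Z (a *: x + y).
Proof.
move=> hx hy p; have [x' [x1 x2 x3]] := hx p; have [y' [y1 y2 y3]] := hy p.
by exists (a *: x' + y'); split; rewrite ?linearP;
  [exact: filtZD|exact: filtZD|exact: agreeZD].
Qed.
Lemma in_B0 : in_B 0.
Proof.
by move=> p; exists 0; split; rewrite ?linear0 //; exact: filt0.
Qed.
Lemma in_BZD a x y : in_B x -> in_B y -> in_B (a *: x + y).
Proof.
move=> hx hy p; have [x' [x1 x2 x3]] := hx p; have [y' [y1 y2 y3]] := hy p.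
by exists (a *: x' + y'); split; rewrite ?linearP;
  [exact: filtZD|exact: filtZD|exact: agreeZD].
Qed.
Definition page_Z : submod chains := Submod in_Z0 in_ZZD.
Definition page_B : submod chains := Submod in_B0 in_BZD.

Definition page : gmod :=
  @Gmod (subquo page_Z page_B) (fun a b c u =>
    exists x, [/\ page_Z x, has_deg a b c x & u = cls page_Z page_B x]).

(* Componentwise, x in gr^p C lifts to y in Z_k^p, and z in gr^(p+k) C is the
   image of dy: the differential of E_k sends [x] to [z]. *)
Definition zigzag (x z : chains) : Prop := forall p, exists y : chains,
  [/\ filt p y, filt (p + k%:Z) (dtot y), agree p y x &
      agree (p + k%:Z) (dtot y) z].

Lemma zigzagZD a x z x' z' :
  zigzag x z -> zigzag x' z' -> zigzag (a *: x + x') (a *: z + z').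
Proof.
move=> h h' p; have [y [y1 y2 y3 y4]] := h p.
have [y' [y'1 y'2 y'3 y'4]] := h' p.
by exists (a *: y + y'); split; rewrite ?linearP;
  [exact: filtZD|exact: filtZD|exact: agreeZD|exact: agreeZD].
Qed.

Lemma zigzag_ex x : page_Z x -> exists z, zigzag x z.
Proof.
move=> hx; have [y hy] := choice hx.
exists [ffun i => dtot (y (v i - k%:Z)) i] => p; exists (y p).
have [y1 y2 y3] := hy p; split=> // i vi.
by rewrite ffunE vi addrK.
Qed.

Lemma zigzag_Z x z : zigzag x z -> page_Z z.
Proof.
move=> h p; have [y [y1 y2 y3 y4]] := h (p - k%:Z).
rewrite subrK in y2 y4; exists (dtot y); split=> //.
by rewrite dtotK; exact: filt0.
Qed.

Lemma zigzag_B x z : page_B x -> zigzag x z -> page_B z.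
Proof.
move=> hx h p; have [y [y1 y2 y3 y4]] := h (p - k%:Z).
have [w [w1 w2 w3]] := hx (p - k%:Z); rewrite subrK in y2 y4.
have dyw : dtot (y - dtot w) = dtot y.
  by rewrite -[RHS]subr0 -(dtotK w); exact: linearB.
exists (y - dtot w); rewrite dyw; split=> // i hi.
have -> : (y - dtot w) i = y i - dtot w i by rewrite !ffunE.
have : v i <= p - k%:Z by rewrite -ltzD1.
rewrite le_eqVlt => /orP[/eqP vi|vi].
  by rewrite y3 // w3 // subrr.
by rewrite y1 // w2 // subr0.
Qed.

Definition page_d (u : page) : page :=
  cls page_Z page_B (projT1 (cid (zigzag_ex (repP u)))).

Lemma page_dE x z : page_Z x -> zigzag x z ->
  page_d (cls page_Z page_B x) = cls page_Z page_B z.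
Proof.
move=> Zx xz; rewrite /page_d; case: cid => z' /= x'z'.
apply/clsP; [exact: zigzag_Z x'z'|exact: zigzag_Z xz|].
have xz1 := zigzagZD (-1) xz x'z'; rewrite !scaleN1r in xz1.
rewrite addrC; apply: zigzag_B xz1; rewrite addrC.
by apply/(clsP page_B (repP _) Zx); exact: repK.
Qed.

Lemma page_d_is_linear : linear page_d.
Proof.
move=> a u w; have [z uz] := zigzag_ex (repP u).
have [z' wz] := zigzag_ex (repP w).
have uwE : a *: u + w = cls page_Z page_B (a *: rep u + rep w).
  by rewrite clsZD ?repK //; exact: repP.
rewrite uwE (page_dE _ (zigzagZD a uz wz)); last exact: submodZD (repP u) (repP w).
rewrite clsZD; [|exact: zigzag_Z uz|exact: zigzag_Z wz].
by rewrite -(page_dE (repP u) uz) -(page_dE (repP w) wz); rewrite !repK.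
Qed.
HB.instance Definition _ := GRing.isLinear.Build rat page page _ page_d page_d_is_linear.

End Page.

Definition H_tot : lmodType rat := subquo (cycles dtot) (boundaries dtot).

(* F^p H(C, d_+ + d_v): the image of the homology of F^p. *)
Definition H_filt_mem (p : int) (u : H_tot) : Prop := exists x,
  [/\ filt p x, cycles dtot x & u = cls (cycles dtot) (boundaries dtot) x].

Lemma H_filt0 p : H_filt_mem p 0.
Proof. by exists 0; split; [exact: filt0|exact: submod0|rewrite cls0]. Qed.
Lemma H_filtZD p a u w :
  H_filt_mem p u -> H_filt_mem p w -> H_filt_mem p (a *: u + w).
Proof.
move=> [x [x1 x2 ->]] [y [y1 y2 ->]]; exists (a *: x + y); split.
- exact: filtZD.
- exact: submodZD.
- by rewrite clsZD.
Qed.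
Definition H_filt p : submod H_tot := Submod (H_filt0 p) (@H_filtZD p).

(* The summand E_k^p of E_k. *)
Definition page_col_mem (k : nat) (p : int) (u : page k) : Prop := exists x,
  [/\ page_Z k x, (forall i : gen C, v i != p -> x i = 0) &
      u = cls (page_Z k) (page_B k) x].

Lemma page_col0 k p : page_col_mem (k := k) p 0.
Proof.
by exists 0; split; [exact: submod0|move=> i _; rewrite ffunE|rewrite cls0].
Qed.
Lemma page_colZD k p a (u w : page k) :
  page_col_mem p u -> page_col_mem p w -> page_col_mem p (a *: u + w).
Proof.
move=> [x [x1 x2 ->]] [y [y1 y2 ->]]; exists (a *: x + y); split.
- exact: submodZD.
- by move=> i hi; rewrite !ffunE x2 // y2 // scaler0 addr0.
- by rewrite clsZD.
Qed.
Definition page_col k p : submod (page k) :=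
  Submod (page_col0 k p) (@page_colZD k p).

(* The abutment H(C, d_+ + d_v) is M, its filtration is bounded, and the pages
   stabilise to E_oo with E_oo^p = F^p H / F^(p+1) H. *)
Definition converges_to (M : lmodType rat) : Prop :=
  [/\ lin_iso H_tot M,
      exists p0 p1, (forall u, H_filt p0 u) /\ (forall u, H_filt p1 u -> u = 0)
    & exists N, forall k, (N <= k)%N ->
        (forall u, page_d (k := k) u = 0) /\
        (forall p, lin_iso (subquo (page_col k p) (zero_submod (page k)))
                           (subquo (H_filt p) (H_filt (p + 1))))].

End SpectralSequence.

(* Cubes of maps over R on the subsets of A: kap a s is the component, in the
   direction a, from s :\ a to s; with the sign cube_sign a s the commuting
   squares of kap become anticommuting. *)
Section Cube.
Variables (A : finType) (R : comAlgType rat).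
Variable kap : A -> {set A} -> R.
Hypothesis kapC : forall (s : {set A}) a b, a \in s -> b \in s -> a != b ->
  kap a s * kap b (s :\ a) = kap b s * kap a (s :\ b).

Definition cube_sign (a : A) (s : {set A}) : rat :=
  (-1) ^+ #|[set b in s | (enum_rank b < enum_rank a)%N]|.

Definition cube_d (P : pred A) (x : {ffun {set A} -> R}) : {ffun {set A} -> R} :=
  [ffun s : {set A} => \sum_(a in s | P a) cube_sign a s *: (kap a s * x (s :\ a))].

Lemma cube_d_is_linear P : linear (cube_d P).
Proof.
move=> a x y; apply/ffunP => s; rewrite !ffunE scaler_sumr -big_split /=.
apply: eq_bigr => b _; rewrite !ffunE mulrDr scalerDr; congr (_ + _).
by rewrite -scalerAr !scalerA mulrC.
Qed.
HB.instance Definition _ P := GRing.isLinear.Build rat {ffun {set A} -> R}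
  {ffun {set A} -> R} _ (cube_d P) (cube_d_is_linear P).

Lemma cube_signC a b (s : {set A}) : a \in s -> b \in s -> a != b ->
  cube_sign a s * cube_sign b (s :\ a) = - (cube_sign b s * cube_sign a (s :\ b)).
Proof.
wlog ab : a b / (enum_rank a < enum_rank b)%N.
  move=> hw sa sb nab; case: (ltngtP (enum_rank a) (enum_rank b)) => h.
  - exact: hw.
  - by rewrite (hw b a) ?opprK // eq_sym.
  - by case/eqP: nab; apply/enum_rank_inj/ord_inj.
move=> sa sb nab; rewrite /cube_sign.
rewrite (cardsD1 a [set b0 in s | (enum_rank b0 < enum_rank b)%N]) inE sa ab /=.
have -> : [set b0 in s | (enum_rank b0 < enum_rank b)%N] :\ a =
          [set b0 in s :\ a | (enum_rank b0 < enum_rank b)%N].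
  by apply/setP => z; rewrite !inE andbA.
have -> : [set b0 in s :\ b | (enum_rank b0 < enum_rank a)%N] =
          [set b0 in s | (enum_rank b0 < enum_rank a)%N].
  apply/setP => z; rewrite !inE; case: eqVneq => //= ->.
  by rewrite (ltnNge _ (enum_rank a)) (ltnW ab) andbF.
by rewrite add1n exprS mulN1r mulNr opprK mulrC.
Qed.

Lemma cube_d_anti P Q x : cube_d P (cube_d Q x) + cube_d Q (cube_d P x) = 0.
Proof.
apply/ffunP => s; rewrite !ffunE.
pose T a b := cube_sign a s *: (kap a s *
  (cube_sign b (s :\ a) *: (kap b (s :\ a) * x (s :\ a :\ b)))).
have E P' Q' : \sum_(a in s | P' a) cube_sign a s *: (kap a s * cube_d Q' x (s :\ a))
   = \sum_(a in s | P' a) \sum_(b in s | Q' b && (b != a)) T a b.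
  apply: eq_bigr => a _; rewrite ffunE mulr_sumr scaler_sumr.
  by apply: eq_bigl => b; rewrite !inE -!andbA; do !case: (_ \in _); rewrite /= ?andbF ?andbT // andbC.
rewrite !E [X in _ + X](exchange_big_dep (fun b => (b \in s) && P b)) /=; last first.
  by move=> a b _ /andP[-> /andP[]].
rewrite -big_split big1 //= => a /andP[sa Pa].
rewrite [X in _ + X](eq_bigl (fun b => (b \in s) && (Q b && (b != a)))); last first.
  by move=> b; rewrite sa Pa /= [a == b]eq_sym andbA.
rewrite -big_split big1 //= => b /andP[sb /andP[Qb ba]].
rewrite /T -!scalerAr !scalerA !mulrA kapC 1?eq_sym //.
rewrite cube_signC 1?eq_sym // setDDl setUC -setDDl.
by rewrite scaleNr addNr.
Qed.

Lemma cube_dK P x : cube_d P (cube_d P x) = 0.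
Proof.
have := cube_d_anti P P x; rewrite -mulr2n -scaler_nat => /eqP.
by rewrite scaler_eq0 pnatr_eq0 => /eqP.
Qed.

End Cube.

(* Closed diagrams without singular crossings, as oriented graphs with labelled
   crossings: the oriented resolution joins in_i to out_k and in_j to out_l.
   The last two fields say that every edge leaves exactly one vertex and enters
   exactly one.  The embedding in the plane is part of closed_braid below. *)
Record diagram := Diagram {
  edge : finType;
  mark : finType;
  crossing : finType;
  mark_in : mark -> edge;
  mark_out : mark -> edge;
  in_i : crossing -> edge;
  in_j : crossing -> edge;
  out_k : crossing -> edge;
  out_l : crossing -> edge;
  positive : crossing -> bool;
  edge_tail : perm_eq (codom mark_out ++ codom out_k ++ codom out_l) (enum edge);
  edge_head : perm_eq (codom mark_in ++ codom in_i ++ codom in_j) (enum edge)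
}.

Section Diagram.
Variable D : diagram.

Definition vertex : finType := (mark D + crossing D)%type.

(* e' follows e along the link. *)
Definition strand : rel (edge D) := fun e e' =>
  [|| [exists m, (mark_in m == e) && (mark_out m == e')],
      [exists c, (in_j c == e) && (out_k c == e')] |
      [exists c, (in_i c == e) && (out_l c == e')]].

Definition is_knot : Prop :=
  (0 < #|edge D|)%N /\ forall e e', connect strand e e'.

Definition writhe : int :=
  #|[set c | positive (d := D) c]|%:Z - #|[set c | ~~ positive (d := D) c]|%:Z.

(* f p and g p are the p-th edges from the left just below and just above the
   vertex v, which lies at position p (at p and p+1 for a crossing).  The labels
   do not say which of (i,k), (j,l) is the left-hand pair. *)
Definition braid_step (b p : nat) (v : vertex) (f g : nat -> edge D) : Prop :=
  match v with
  | inl m => [/\ (p < b)%N, f p = mark_in m, g p = mark_out m &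
                 forall q, q != p -> g q = f q]
  | inr c => [/\ (p.+1 < b)%N,
                 perm_eq [:: (f p, g p); (f p.+1, g p.+1)]
                         [:: (in_i c, out_k c); (in_j c, out_l c)] &
                 forall q, q != p -> q != p.+1 -> g q = f q]
  end.

(* D is the closure of a braid on b strands, possibly with marks: s lists the
   vertices from bottom to top with their positions, and lev t p is the p-th edge
   just above the first t vertices. *)
Definition closed_braid (b : nat) : Prop :=
  exists (s : seq (nat * vertex)) (lev : nat -> nat -> edge D),
    [/\ perm_eq (unzip2 s) (enum vertex),
        forall t, (t <= size s)%N -> {in gtn b &, injective (lev t)},
        forall t p v, onth s t = Some (p, v) ->
          braid_step b p v (lev t) (lev t.+1)
      & forall p, (p < b)%N -> lev (size s) p = lev 0%N p].

Definition edge_poly := {mpoly rat[#|edge D|]}.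
Definition Xe (e : edge D) : edge_poly := 'X_(enum_rank e).

Definition rho (v : vertex) : edge_poly :=
  match v with
  | inl m => Xe (mark_out m) - Xe (mark_in m)
  | inr c => (Xe (out_k c) + Xe (out_l c)) - (Xe (in_i c) + Xe (in_j c))
  end.

Definition rho_ideal : {pred edge_poly} :=
  fun p => `[< exists c : vertex -> edge_poly, p = \sum_v c v * rho v >].

Lemma rho_ideal_closed : idealr_closed rho_ideal.
Proof.
split.
- apply/asboolP; exists (fun _ => 0).
  by rewrite big1 // => v _; rewrite mul0r.
- apply/asboolP => -[c /(congr1 (meval (fun _ => 0)))].
  rewrite rmorph1 rmorph_sum big1 => [/eqP|v _]; first by rewrite oner_eq0.
  have X0 e : meval (fun _ => 0) (Xe e) = 0 :> rat by exact: mevalXU.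
  rewrite rmorphM; case: v => [m|c'] /=.
    by rewrite rmorphB /= [X in X - _]X0 [X in _ - X]X0 subrr mulr0.
  by rewrite rmorphB 2!rmorphD /= ![meval _ (Xe _)]X0 !addr0 ?subrr mulr0.
- move=> a p q /asboolP[c ->] /asboolP[c' ->]; apply/asboolP.
  exists (fun v => a * c v + c' v); rewrite mulr_sumr -big_split /=.
  by apply: eq_bigr => v _; rewrite mulrDl mulrA.
Qed.
HB.instance Definition _ :=
  isIdealr.Build edge_poly rho_ideal rho_ideal_closed.

Definition edge_ring : Type := Quotient.quot rho_ideal.
HB.instance Definition _ := GRing.ComNzRing.on edge_ring.

Definition edge_pi (p : edge_poly) : edge_ring := \pi_(Quotient.quot rho_ideal) p.

Lemma edge_pi_is_zmod : zmod_morphism edge_pi.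
Proof. exact: (@raddfB _ _ \pi_(Quotient.quot rho_ideal)). Qed.
Lemma edge_pi_is_monoid : monoid_morphism edge_pi.
Proof.
by split; [exact: (rmorph1 \pi_(Quotient.quot rho_ideal))
          |exact: (rmorphM \pi_(Quotient.quot rho_ideal))].
Qed.
HB.instance Definition _ :=
  GRing.isZmodMorphism.Build edge_poly edge_ring edge_pi edge_pi_is_zmod.
HB.instance Definition _ :=
  GRing.isMonoidMorphism.Build edge_poly edge_ring edge_pi edge_pi_is_monoid.

Definition edge_scale (a : rat) (x : edge_ring) : edge_ring :=
  edge_pi a%:MP * x.
Lemma edge_scaleA a b x : edge_scale a (edge_scale b x) = edge_scale (a * b) x.
Proof. by rewrite /edge_scale mulrA -rmorphM -mpolyCM. Qed.
Lemma edge_scale1 : left_id 1 edge_scale.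
Proof. by move=> x; rewrite /edge_scale mpolyC1 rmorph1 mul1r. Qed.
Lemma edge_scaleDr : right_distributive edge_scale +%R.
Proof. by move=> a x y; rewrite /edge_scale mulrDr. Qed.
Lemma edge_scaleDl x : {morph edge_scale^~ x : a b / a + b}.
Proof. by move=> a b; rewrite /edge_scale mpolyCD rmorphD mulrDl. Qed.
HB.instance Definition _ := GRing.Zmodule_isLmodule.Build rat edge_ring
  edge_scaleA edge_scale1 edge_scaleDr edge_scaleDl.
Lemma edge_scaleAl a (x y : edge_ring) : a *: (x * y) = (a *: x) * y.
Proof. exact: mulrA. Qed.
HB.instance Definition _ :=
  GRing.Lmodule_isLalgebra.Build rat edge_ring edge_scaleAl.
Lemma edge_scaleAr a (x y : edge_ring) : a *: (x * y) = x * (a *: y).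
Proof. exact: mulrCA. Qed.
HB.instance Definition _ :=
  GRing.Lalgebra_isAlgebra.Build rat edge_ring edge_scaleAr.

(* The Q-subalgebra generated by the differences X_e - X_e'. *)
Definition in_reduced : {pred edge_ring} := fun x => `[<
  forall S : {pred edge_ring}, subalg_closed S ->
    (forall e e', edge_pi (Xe e - Xe e') \in S) -> x \in S >].

Lemma in_reduced_closed : subalg_closed in_reduced.
Proof.
split.
- by apply/asboolP => S [].
- move=> a x y /asboolP hx /asboolP hy; apply/asboolP => S hS hX.
  by case: (hS) => _ + _; apply; [exact: hx|exact: hy].
- move=> x y /asboolP hx /asboolP hy; apply/asboolP => S hS hX.
  by case: (hS) => _ _; apply; [exact: hx|exact: hy].
Qed.
HB.instance Definition _ :=
  GRing.isSubalgClosed.Build rat edge_ring in_reduced in_reduced_closed.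

Record reduced_ring := ReducedRing {
  reduced_val : edge_ring; reduced_valP : reduced_val \in in_reduced }.
HB.instance Definition _ := [isSub for reduced_val].
HB.instance Definition _ := [Choice of reduced_ring by <:].
HB.instance Definition _ := [SubChoice_isSubComNzRing of reduced_ring by <:].
HB.instance Definition _ := [SubZmodule_isSubLmodule of reduced_ring by <:].
HB.instance Definition _ :=
  [SubNzRing_SubLmodule_isSubLalgebra of reduced_ring by <:].
HB.instance Definition _ := [SubLalgebra_isSubAlgebra of reduced_ring by <:].

Lemma diff_reduced e e' : edge_pi (Xe e - Xe e') \in in_reduced.
Proof. by apply/asboolP => S _; apply. Qed.
Definition Xdiff (e e' : edge D) : reduced_ring := ReducedRing (diff_reduced e e').

(* The grading with q(X_e) = 2. *)
Definition reduced_qdeg (n : int) (x : reduced_ring) : Prop :=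
  x = 0 \/ exists m (p : edge_poly),
    [/\ n = 2 * m%:Z, p \is m.-homog & reduced_val x = edge_pi p].

End Diagram.

Section RasmussenComplex.
Variable D : diagram.

(* Each factor is free on {A, B, A', B'}, indexed by (h, v) in bool * bool:
   A = (0,0), B = (1,0), A' = (0,1), B' = (1,1).  The tensor product over R of
   all the factors is then free on the subsets s of bool * crossing D, where
   (false, c) \in s and (true, c) \in s are the bits h and v at c. *)
Definition hbit (c : crossing D) (s : {set bool * crossing D}) : bool :=
  (false, c) \in s.
Definition vbit (c : crossing D) (s : {set bool * crossing D}) : bool :=
  (true, c) \in s.

Definition local_q (c : crossing D) (h v : bool) : int :=
  match positive c, h, v with
  | true, false, false => 2
  | false, true, true => -2
  | _, _, _ => 0
  end.
Definition local_h (c : crossing D) (h : bool) : int := if h then 0 else -1.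
Definition local_v (c : crossing D) (v : bool) : int :=
  match positive c, v with
  | true, false => -1
  | true, true => 0
  | false, false => 0
  | false, true => 1
  end.

(* The map A -> B if v = 0, A' -> B' if v = 1. *)
Definition local_dplus (c : crossing D) (v : bool) : reduced_ring D :=
  let linear_map := Xdiff (out_k c) (in_i c) in
  let quadratic_map :=
    - (Xdiff (out_k c) (in_i c) * Xdiff (out_k c) (in_j c)) in
  match positive c, v with
  | true, false => quadratic_map
  | true, true => linear_map
  | false, false => linear_map
  | false, true => quadratic_map
  end.

(* The map A -> A' if h = 0, B -> B' if h = 1. *)
Definition local_dvert (c : crossing D) (h : bool) : reduced_ring D :=
  match positive c, h with
  | true, false => Xdiff (in_j c) (out_k c)
  | true, true => 1
  | false, false => 1
  | false, true => Xdiff (in_j c) (out_k c)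
  end.

Definition crossing_map (a : bool * crossing D) (s : {set bool * crossing D}) :
    reduced_ring D :=
  if a.1 then local_dvert a.2 (hbit a.2 s) else local_dplus a.2 (vbit a.2 s).

Lemma local_square (c : crossing D) :
  local_dplus c true * local_dvert c false =
  local_dvert c true * local_dplus c false.
Proof.
have E : Xdiff (in_j c) (out_k c) = - Xdiff (out_k c) (in_j c) :> reduced_ring D.
  by apply: val_inj; rewrite raddfN /= -raddfN opprB.
rewrite /local_dplus /local_dvert; case: (positive c) => /=.
  by rewrite E mul1r; exact: mulrN.
by rewrite E mulr1 [RHS]mulrC; exact/esym/mulrN.
Qed.

Lemma crossing_mapC (s : {set bool * crossing D}) a b :
  a \in s -> b \in s -> a != b ->
  crossing_map a s * crossing_map b (s :\ a) =
  crossing_map b s * crossing_map a (s :\ b).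
Proof.
case: a b => [[] c] [[] c'] sa sb ab; rewrite /crossing_map /hbit /vbit /= !inE
  -!pair_eqE /= ?andbT //=; try exact: mulrC.
- rewrite [c' == c]eq_sym; case: (eqVneq c c') sa sb => [->|_] sa sb /=.
    by rewrite sa sb local_square.
  exact: mulrC.
- rewrite [c' == c]eq_sym; case: (eqVneq c c') sa sb => [->|_] sa sb /=.
    by rewrite sa sb local_square.
  exact: mulrC.
Qed.

Definition C_r : bicomplex :=
  @Bicomplex {set bool * crossing D} (reduced_ring D) (@reduced_qdeg D)
    (fun s => \sum_c local_q c (hbit c s) (vbit c s))
    (fun s => \sum_c local_h c (hbit c s))
    (fun s => \sum_c local_v c (vbit c s))
    (cube_d crossing_map (fun a => ~~ a.1))
    (cube_d crossing_map (fun a => a.1))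
    (cube_dK crossing_mapC _) (cube_dK crossing_mapC _)
    (cube_d_anti crossing_mapC _ _).

Variable b : nat.

Definition KR_shift (M : gmod) : gmod :=
  gshift M (- writhe D + b%:Z - 1) (writhe D + b%:Z - 1) (writhe D - b%:Z + 1).

Definition reduced_HOMFLY : gmod := KR_shift (H_vert C_r).

Definition E_minus1 (k : nat) : gmod := KR_shift (page C_r k).
Definition d_minus1 (k : nat) : {linear E_minus1 k -> E_minus1 k} :=
  @page_d C_r k.

End RasmussenComplex.

(* Main.v *)
(* The total complex is a tensor product over the reduced ring R of one square
   for each crossing c, and each square has an edge on which d_v is the identity.
   Cancelling it leaves the Koszul factor R -> R given by z_c = X_j - X_k.
   Passing c changes the variable of the current edge by z_c on one strand and by
   -z_c on the other, so going once around a knot expresses all the differences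
   X_e - X_e' through the z_c and imposes no relation between them: R is the
   polynomial ring in the z_c.  The z_c therefore form a regular sequence with
   quotient Q, which is the total homology.  The pages are handled on the level
   of chains: x in Z_k lies in Z_(k+1) iff d_k [x] = 0, and B_(k+1) consists of
   the chains whose class in E_k is in the image of d_k. *)

Require Import Defs.
From HB Require Import structures.
From mathcomp Require Import all_boot all_order all_algebra.
From mathcomp Require Import mpoly boolp zify ring.
Import Order.TTheory GRing.Theory Num.Theory.
Local Open Scope ring_scope.

(** * Linear isomorphisms out of subquotients *)

Section LinearIsomorphisms.
Set Implicit Arguments.
Unset Strict Implicit.

(** The first isomorphism theorem for a bare function [g], linear only on [Z]: many of its uses
    compose with [cls], which is linear only on its numerator. *)
Lemma subquo_iso (V W : lmodType rat) (Z B : submod V) (g : V -> W) :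
    (forall a x y, Z x -> Z y -> g (a *: x + y) = a *: g x + g y) ->
    (forall x, Z x -> (g x = 0 <-> B x)) ->
    (forall w, exists2 x, Z x & g x = w) ->
  exists2 f : {linear subquo Z B -> W}, bijective f &
    forall x, Z x -> f (cls Z B x) = g x.
Proof.
move=> gl gk gs.
have gE x y : Z x -> Z y -> (g x = g y <-> B (x - y)).
  move=> Zx Zy; have Zxy : Z (x - y).
    by rewrite addrC -scaleN1r; exact: submodZD.
  rewrite -(gk _ Zxy) addrC -scaleN1r gl // scaleN1r addrC; split=> [->|/eqP].
    by rewrite subrr.
  by rewrite subr_eq0 => /eqP.
pose f (u : subquo Z B) : W := g (rep u).
have fE x : Z x -> f (cls Z B x) = g x.
  move=> Zx; apply/gE => //; first exact: repP.
  by apply/(clsP _ (repP _) Zx); exact: repK.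
have fl : linear f.
  move=> a u v; rewrite -[in LHS](repK u) -[in LHS](repK v).
  rewrite -clsZD; [|exact: repP..].
  rewrite fE; last by apply: submodZD; exact: repP.
  by rewrite gl //; exact: repP.
pose fL : {linear subquo Z B -> W} :=
  HB.pack f (GRing.isLinear.Build rat (subquo Z B) W _ f fl).
exists fL => //; pose h w := cls Z B (s2val (cid2 (gs w))).
exists h => [u|w] /=; rewrite /h; case: cid2 => x Zx gx /=.
  by rewrite -[RHS]repK; apply/(clsP _ Zx (repP _))/gE; rewrite //; exact: repP.
by rewrite fE.
Qed.

Lemma linear_inverse (V W : lmodType rat) (f : {linear V -> W}) : bijective f ->
  exists2 g : {linear W -> V}, cancel f g & cancel g f.
Proof.
move=> [g fK gK].
have gl : linear g.
  by move=> a x y; apply: (can_inj fK); rewrite linearP !gK.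
pose gL : {linear W -> V} := HB.pack g (GRing.isLinear.Build rat W V _ g gl).
by exists gL.
Qed.

Lemma lin_iso_sym (V W : lmodType rat) : lin_iso V W -> lin_iso W V.
Proof.
by move=> [f /linear_inverse[g fK gK]]; exists g; exists f.
Qed.

Lemma lin_iso_trans (U V W : lmodType rat) :
  lin_iso U V -> lin_iso V W -> lin_iso U W.
Proof.
move=> [f fb] [g gb].
by exists (g \o f : {linear U -> W}); exact: bij_comp.
Qed.

Lemma giso_sym (M N : gmod) : giso M N -> giso N M.
Proof.
move=> [f /linear_inverse[g fK gK] fd]; exists g; first by exists f.
by move=> a b c x; rewrite fd gK.
Qed.

Lemma giso_trans (M N P : gmod) : giso M N -> giso N P -> giso M P.
Proof.
move=> [f fb fd] [g gb gd].
exists (g \o f : {linear M -> P}); first exact: bij_comp.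
by move=> a b c x; rewrite fd gd.
Qed.

Lemma giso_homology (M N : gmod) (d : {linear M -> M}) (e : {linear N -> N}) :
  dgiso d e -> giso (homology d) (homology e).
Proof.
move=> [f /linear_inverse[g fK gK] [fd fde]].
have gde x : g (e x) = d (g x) by rewrite -[x in LHS]gK -fde fK.
have cyc x : cycles d x -> cycles e (f x).
  by rewrite /= -fde => ->; rewrite linear0.
have [||w|F Fb FE] := @subquo_iso _ (homology e) (cycles d) (boundaries d)
    (fun x => cls (cycles e) (boundaries e) (f x)).
- by move=> a x y dx dy; rewrite linearP clsZD //; exact: cyc.
- move=> x dx; rewrite -[X in _ = X]cls0; split.
    move/(clsP _ (cyc _ dx) (submod0 _)); rewrite subr0 => -[y fxy].
    by exists (g y); rewrite -gde -fxy fK.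
  move=> [y xy]; apply/(clsP _ (cyc _ dx) (submod0 _)); rewrite subr0.
  by exists (f y); rewrite -fde xy.
- exists (g (rep w)); last by rewrite gK repK.
  by have /= ew := repP w; rewrite /= -gde ew linear0.
exists F => // a b c u; split=> [[x [dx xd ->]]|[y [ey yd Fu]]].
  by rewrite FE //; exists (f x); split=> //; [exact: cyc|exact/fd].
have dgy : d (g y) = 0 by rewrite -gde ey linear0.
exists (g y); split=> //; first by apply/fd; rewrite gK.
by apply: (bij_inj Fb); rewrite FE // gK.
Qed.

Lemma giso_gshift (M N : gmod) a b c :
  giso M N -> giso (gshift M a b c) (gshift N a b c).
Proof. by move=> [f fb fd]; exists f => // a' b' c' x; exact: fd. Qed.

Lemma dgiso_gshift (M N : gmod) (d : M -> M) (e : N -> N) a b c : dgiso d e ->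
  @dgiso (gshift M a b c) (gshift N a b c) d e.
Proof.
by move=> [f fb [fd fde]]; exists f => //; split=> // a' b' c' x; exact: fd.
Qed.

(* Not an identity: the closure proofs inside [cycles] mention the grading. *)
Lemma homology_gshift (M : gmod) (d : {linear M -> M}) a b c :
  giso (@homology (gshift M a b c) d) (gshift (homology d) a b c).
Proof.
pose cl := cls (cycles d) (boundaries d).
have [||u|F Fb FE] := @subquo_iso _ (homology d)
    (@cycles (gshift M a b c) d) (@boundaries (gshift M a b c) d) cl.
- by move=> e x y dx dy; exact: clsZD.
- move=> x dx; rewrite -[X in _ = X]cls0.
  by rewrite (clsP (boundaries d) (dx : cycles d x) (submod0 _)) subr0.
- by exists (rep u); [exact: (repP u)|exact: repK].
exists F => // a' b' c' u; split=> [[x [dx xd ->]]|[x [dx xd Fu]]].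
  by rewrite FE //; exists x.
by exists x; split=> //; apply: (bij_inj Fb); rewrite FE.
Qed.

End LinearIsomorphisms.

(** * Each page as the homology of the one before *)

Section Pages.
Set Implicit Arguments.
Unset Strict Implicit.
Variable C : bicomplex.
Local Notation v := (@gr_v C).

Lemma filt_le p q (x : chains C) : q <= p -> filt p x -> filt q x.
Proof. by move=> qp xp i vi; apply: xp; exact: lt_le_trans vi qp. Qed.

Lemma chainsD (x y : chains C) i : (x + y) i = x i + y i.
Proof. exact: ffunE. Qed.

Lemma chainsB (x y : chains C) i : (x - y) i = x i - y i.
Proof. by rewrite chainsD ffunE. Qed.

Lemma dtot_subr_boundary (x y : chains C) :
  dtot C x = 0 -> dtot C (x - dtot C y) = 0.
Proof.
move=> dx; transitivity (dtot C x - dtot C (dtot C y)); first exact: linearB.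
by rewrite dx dtotK subr0.
Qed.

Definition column p (x : chains C) : chains C :=
  [ffun i => if v i == p then x i else 0].

Lemma column_filt p x : filt p (column p x).
Proof. by move=> i vi; rewrite ffunE lt_eqF. Qed.

Lemma column_agree p x : agree p (column p x) x.
Proof. by move=> i vi; rewrite ffunE vi eqxx. Qed.

Lemma page_clsE k (u : page C k) :
  exists2 x, page_Z C k x & u = cls (page_Z C k) (page_B C k) x.
Proof. by exists (rep u); [exact: repP|rewrite repK]. Qed.

Lemma page_dK k (u : page C k) : page_d (page_d u) = 0.
Proof.
have [x Zx ->] := page_clsE u; have [z xz] := zigzag_ex Zx.
rewrite (page_dE Zx xz) (page_dE (zigzag_Z xz) (z := 0)) ?cls0 // => p.
have [y [y1 y2 y3 y4]] := xz (p - k%:Z); rewrite subrK in y2 y4.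
exists (dtot C y); split=> //; rewrite dtotK; first exact: filt0.
by [].
Qed.

Lemma cls_page_eq0 k (x : chains C) : page_Z C k x ->
  cls (page_Z C k) (page_B C k) x = 0 <-> page_B C k x.
Proof.
move=> Zx; rewrite -[X in _ = X]cls0.
by rewrite (clsP _ Zx (submod0 _)) subr0.
Qed.

(** If d_k [x] = [z] vanishes, then in column p + k [z] is [dtot C w] with [w] in F^(p+1), so
    [y - w] still lifts [x] while its differential loses column p + k. Conversely, a lift for
    [page_Z C k.+1] is a zigzag from [x] to 0. *)
Lemma page_d_eq0 k (x : chains C) : page_Z C k x ->
  page_d (cls (page_Z C k) (page_B C k) x) = 0 <-> page_Z C k.+1 x.
Proof.
move=> Zx; split=> [|Zx'].
  have [z xz] := zigzag_ex Zx; rewrite (page_dE Zx xz).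
  move/(cls_page_eq0 (zigzag_Z xz)) => Bz p.
  have [y [y1 y2 y3 y4]] := xz p; have [w [w1 w2 w3]] := Bz (p + k%:Z).
  rewrite addrK in w1; exists (y - w).
  have wp i : v i <= p -> w i = 0.
    by move=> vi; apply: w1; rewrite ltzD1.
  split=> [i vi|i vi|i vi].
  - by rewrite chainsB y1 // wp ?subr0 // ltW.
  - have dyw : dtot C (y - w) = dtot C y - dtot C w by exact: linearB.
    rewrite dyw chainsB.
    have : v i <= p + k%:Z.
      by rewrite -ltzD1 -addrA -[k%:Z + 1]/((k + 1)%N%:Z) addn1.
    rewrite le_eqVlt => /predU1P[vi'|vi'].
      by rewrite y4 // -w3 // subrr.
    by rewrite y2 // w2 // subrr.
  - by rewrite chainsB wp ?vi // subr0 y3.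
rewrite (page_dE Zx (z := 0)) ?cls0 // => p.
have [y [y1 y2 y3]] := Zx' p; exists y; split=> //.
  by apply: filt_le y2; rewrite lerD2l lez_nat.
by move=> i vi; rewrite y2 ?ffunE // vi ltrD2l ltz_nat.
Qed.

Lemma page_ZS k (x : chains C) : page_Z C k.+1 x -> page_Z C k x.
Proof.
move=> Zx p; have [y [y1 y2 y3]] := Zx p; exists y; split=> //.
by apply: filt_le y2; rewrite lerD2l lez_nat.
Qed.

(** A witness for [page_B C k.+1] at p lies in F^(p-k), as does the lift in a zigzag of length k
    ending in column p. Witnesses starting one column later account for [page_B C k]. *)
Lemma page_BS k (x : chains C) :
  page_B C k.+1 x <-> exists x' z, zigzag k x' z /\ page_B C k (x - z).
Proof.
have kS (p : int) : p - k.+1%:Z + 1 = p - k%:Z.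
  by rewrite -addn1 PoszD opprD addrA subrK.
split=> [/choice[y yP]|[x' [z [xz Bz]]] p].
  (* Column q of [x'] is the leading term of the witness for column q + k. *)
  exists [ffun i => y (v i + k%:Z) i], x; split; last first.
    by rewrite subrr; exact: submod0.
  move=> p; have := yP (p + k%:Z); rewrite kS addrK => -[y1 y2 y3].
  by exists (y (p + k%:Z)); split=> // i vi; rewrite ffunE vi.
have [y [y1 y2 y3 y4]] := xz (p - k%:Z); have [w [w1 w2 w3]] := Bz p.
rewrite subrK in y2 y4; exists (w + y); rewrite kS.
have dwy : dtot C (w + y) = dtot C w + dtot C y by exact: linearD.
split=> [i vi|i vi|i vi].
- by rewrite chainsD y1 // addr0 w1 // ltzD1 ltW.
- by rewrite dwy chainsD w2 // y2 // addr0.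
- by rewrite dwy chainsD w3 // y4 // chainsB subrK.
Qed.

(** Sending [x] in Z_(k+1) to the class of its class in E_k lands in the cycles and is onto by
    [page_d_eq0]; its kernel is B_(k+1) by [page_BS]. *)
Lemma homology_page k :
  giso (homology (@page_d C k : {linear page C k -> page C k})) (page C k.+1).
Proof.
apply: giso_sym; set d := (X in homology X).
set cl := cls (page_Z C k) (page_B C k).
have cyc (x : chains C) : page_Z C k.+1 x -> cycles d (cl x).
  by move=> Zx; apply/page_d_eq0 => //; exact: page_ZS.
have [||w|F Fb FE] := @subquo_iso _ (homology d) (page_Z C k.+1) (page_B C k.+1)
    (fun x => cls (cycles d) (boundaries d) (cl x)).
- move=> a x y Zx Zy; rewrite -clsZD; [|exact: cyc..].
  by congr cls; rewrite /cl clsZD //; exact: page_ZS.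
- move=> x Zx; rewrite -[X in _ = X]cls0 (clsP _ (cyc _ Zx) (submod0 _)) subr0.
  rewrite page_BS; split=> [[u]|[x' [z [xz Bz]]]].
    have [x' Zx' ->] := page_clsE u; have [z xz] := zigzag_ex Zx'.
    rewrite [d _](page_dE Zx' xz) => /(clsP _ (page_ZS Zx) (zigzag_Z xz)) Bxz.
    by exists x', z.
  exists (cl x'); have Zx' : page_Z C k x'.
    by move=> p; have [y [y1 y2 y3 _]] := xz p; exists y.
  rewrite [d _](page_dE Zx' xz).
  by apply/(clsP _ (page_ZS Zx) (zigzag_Z xz)).
- have [x Zx wE] := page_clsE (rep w).
  have dw : d (rep w) = 0 := repP w.
  exists x; first by apply/page_d_eq0 => //; rewrite -wE.
  by rewrite /cl -wE repK.
exists F => // a b c u; split=> [[x [Zx xd ->]]|[w [dw [x [Zx xd wE]] Fu]]].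
  rewrite FE //; exists (cl x); split=> //; first exact: cyc.
  by exists x; split=> //; exact: page_ZS.
have Zx' : page_Z C k.+1 x by apply/page_d_eq0 => //; rewrite -wE.
by exists x; split=> //; apply: (bij_inj Fb); rewrite FE // /cl -wE.
Qed.

End Pages.

(** * The pages E_0, E_1 and E_2 *)

Section FirstPages.
Set Implicit Arguments.
Unset Strict Implicit.
Variable C : bicomplex.
Local Notation v := (@gr_v C).
(** A [bicomplex] does not record the degrees of its maps; these two hypotheses express that d_+
    preserves the column and d_v moves it up by one. *)
Hypothesis dp_agree : forall p (x y : chains C),
  agree p x y -> agree p (dp C x) (dp C y).
Hypothesis dv_agree : forall p (x y : chains C),
  agree p x y -> agree (p + 1) (dv C x) (dv C y).

Lemma dtotE (x : chains C) i : dtot C x i = dp C x i + dv C x i.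
Proof. exact: chainsD. Qed.

Lemma agree0 p (x : chains C) : filt p x -> forall q, q < p -> agree q x 0.
Proof. by move=> xp q qp i vi; rewrite xp ?vi // ffunE. Qed.

Lemma dp_filt p (x : chains C) : filt p x -> filt p (dp C x).
Proof.
move=> xp i vi; rewrite (dp_agree (agree0 xp vi) (erefl (v i))).
by rewrite linear0 ffunE.
Qed.

Lemma dv_filt p (x : chains C) : filt p x -> filt (p + 1) (dv C x).
Proof.
move=> xp i vi; have vi' : v i - 1 < p by rewrite ltrBlDr.
rewrite (dv_agree (agree0 xp vi') (i := i)) ?subrK //.
by rewrite linear0 ffunE.
Qed.

Lemma dtot_filt p (x : chains C) : filt p x -> filt p (dtot C x).
Proof.
move=> xp i vi; rewrite dtotE (dp_filt xp vi) (dv_filt xp) ?addr0 //.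
by apply: lt_trans vi _; rewrite ltrDl.
Qed.

(** Since d_v pushes F^p into F^(p+1), only d_+ is seen in column p. *)
Lemma dtot_agree p (x y : chains C) :
  filt p y -> agree p y x -> agree p (dtot C y) (dp C x).
Proof.
move=> yp yx i vi; rewrite dtotE (dp_agree yx vi) (dv_filt yp) ?addr0 //.
by rewrite vi ltrDl.
Qed.

Lemma page0_Z (x : chains C) : page_Z C 0 x.
Proof.
move=> p; exists (column p x); rewrite addr0; split.
- exact: column_filt.
- by apply: dtot_filt; exact: column_filt.
- exact: column_agree.
Qed.

Lemma page0_B (x : chains C) : x = 0 <-> page_B C 0 x.
Proof.
split=> [->|Bx]; first exact: submod0.
apply/ffunP => i; rewrite ffunE; have [y [y1 y2 y3]] := Bx (v i).
(* For k = 0 the witness [y] starts one column above [v i], so its differential vanishes at [i]. *)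
rewrite -y3 //; apply: (dtot_filt y1).
by rewrite subr0 ltrDl.
Qed.

Lemma page0_dgiso : dgiso (page_d (C := C) (k := 0)) (dp C).
Proof.
have [||w|F Fb FE] := @subquo_iso _ (chains C) (page_Z C 0) (page_B C 0) id.
- by [].
- by move=> x _; exact: page0_B.
- by exists w => //; exact: page0_Z.
exists F => //; split=> [a b c u|u].
  split=> [[x [Zx xd ->]]|ud]; first by rewrite FE.
  exists (F u); split=> //; first exact: page0_Z.
  by apply: (bij_inj Fb); rewrite FE //; exact: page0_Z.
have [x Zx ->] := page_clsE u; rewrite (page_dE Zx (z := dp C x)).
  by rewrite !FE //; exact: page0_Z.
move=> p; have xp := column_filt (p := p) x.
exists (column p x); rewrite addr0; split=> //.
- exact: dtot_filt.
- exact: column_agree.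
- by apply: dtot_agree => //; exact: column_agree.
Qed.

Lemma page1_Z (x : chains C) : page_Z C 1 x <-> cycles (dp C) x.
Proof.
split=> [Zx|dx p].
  apply/ffunP => i; rewrite ffunE; have [y [y1 y2 y3]] := Zx (v i).
  by rewrite -(dtot_agree y1 y3) // y2 // ltrDl.
have xp := column_filt (p := p) x; have xa := column_agree (p := p) x.
exists (column p x); split=> // i; rewrite ltzD1 le_eqVlt => /predU1P[vi|vi].
  by rewrite (dtot_agree xp xa) // dx ffunE.
exact: (dtot_filt xp).
Qed.

Lemma page1_B (x : chains C) : page_B C 1 x <-> boundaries (dp C) x.
Proof.
split=> [/choice[y yP]|[y ->] p].
  exists [ffun i => y (v i) i]; apply/ffunP => i.
  have := yP (v i); rewrite subrK => -[y1 _ y3].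
  rewrite -y3 // (dtot_agree y1 (x := [ffun i => y (v i) i])) // => j vj.
  by rewrite ffunE vj.
have yp := column_filt (p := p) y.
exists (column p y); rewrite subrK; split=> //; first exact: dtot_filt.
by apply: dtot_agree => //; exact: column_agree.
Qed.

(** Z_1 and B_1 are the cycles and boundaries of d_+. For a d_+ cycle [x], the chain [column p x] is
    already a zigzag lift, and its differential in column p + 1 is that of d_v [x]. *)
Lemma page1_dgiso : dgiso (page_d (C := C) (k := 1)) (d_vert_star C).
Proof.
pose cl := cls (cycles (dp C)) (boundaries (dp C)).
have [||w|F Fb FE] := @subquo_iso _ (H_plus C) (page_Z C 1) (page_B C 1) cl.
- by move=> a x y /page1_Z dx /page1_Z dy; exact: clsZD.
- move=> x /page1_Z dx; rewrite -[X in _ = X]cls0 (clsP _ dx (submod0 _)) subr0.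
  by rewrite page1_B.
- by exists (rep w); [apply/page1_Z; exact: repP|exact: repK].
exists F => //; split=> [a b c u|u].
  split=> [[x [Zx xd ->]]|[x [dx xd Fu]]].
    by rewrite FE //; exists x; split=> //; apply/page1_Z.
  have Zx : page_Z C 1 x by exact/page1_Z.
  by exists x; split=> //; apply: (bij_inj Fb); rewrite FE.
have [x Zx ->] := page_clsE u; have dx : cycles (dp C) x by apply/page1_Z.
have Zdvx : page_Z C 1 (dv C x).
  by apply/page1_Z/(induced_cycle (d := dp C)); [exact: d_plus_vert|exact: dx].
rewrite (page_dE Zx (z := dv C x)).
  rewrite !FE // /cl /= /induced.
  (* [induced] applies d_v to a chosen representative [r], which differs from [x] by some d_+ [y];
     anticommutation makes d_v d_+ [y] a d_+ boundary. *)
  set r := rep _; have dr : cycles (dp C) r by exact: repP.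
  have := repK (cl x : H_plus C); rewrite -/r /cl => /(clsP _ dr dx)[y rxy].
  have Zdvr : cycles (dp C) (dv C r).
    by apply: induced_cycle dr; exact: d_plus_vert.
  apply/esym/(clsP _ Zdvr); first by apply/page1_Z.
  have -> : dv C r - dv C x = dv C (r - x) by rewrite linearB.
  exists (- dv C y); rewrite rxy [RHS]linearN.
  by apply/eqP; rewrite -addr_eq0 addrC; apply/eqP; exact: d_plus_vert.
move=> p; have xp := column_filt (p := p) x; have xa := column_agree (p := p) x.
exists (column p x); split=> // i.
  rewrite ltzD1 le_eqVlt => /predU1P[vi|vi]; last exact: (dtot_filt xp).
  by rewrite (dtot_agree xp xa) // dx ffunE.
move=> vi; rewrite dtotE (dv_agree xa vi).
have xa' : agree (p + 1) (column p x) 0.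
  by move=> j vj; rewrite !ffunE vj eq_sym lt_eqF // ltrDl.
by rewrite (dp_agree xa' vi) linear0 ffunE add0r.
Qed.

Lemma page2_giso : giso (page C 2) (H_vert C).
Proof.
apply: giso_trans (giso_homology page1_dgiso).
by apply: giso_sym; exact: homology_page.
Qed.

End FirstPages.

(** * Convergence when all columns lie between -n and n *)

Section Convergence.
Set Implicit Arguments.
Unset Strict Implicit.
Variable C : bicomplex.
Local Notation v := (@gr_v C).
Local Notation Htot := (cls (cycles (dtot C)) (boundaries (dtot C))).

Lemma gr_v_bounded : exists n : nat, forall i, - n%:Z <= v i <= n%:Z.
Proof.
exists (\max_i `|v i|)%N => i; rewrite -ler_norml -abszE lez_nat.
exact: (leq_bigmax i).
Qed.

Variable n : nat.
Hypothesis v_bounded : forall i, - n%:Z <= v i <= n%:Z.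

Lemma filt_low p (x : chains C) : p <= - n%:Z -> filt p x.
Proof.
move=> pn i; rewrite ltNge; case/negP; apply: le_trans pn _.
by case/andP: (v_bounded i).
Qed.

Lemma filt_high p (x : chains C) : n%:Z < p -> filt p x -> x = 0.
Proof.
move=> np xp; apply/ffunP => i; rewrite ffunE xp //.
by apply: le_lt_trans np; case/andP: (v_bounded i).
Qed.

Lemma agree_out p (x y : chains C) : ~~ (- n%:Z <= p <= n%:Z) -> agree p x y.
Proof. by move=> pn i vi; case/negP: pn; rewrite -vi. Qed.

Lemma H_filt_low (u : H_tot C) : H_filt C (- n%:Z) u.
Proof.
exists (rep u); split; [exact: filt_low|exact: repP|by rewrite repK].
Qed.

Lemma H_filt_high (u : H_tot C) : H_filt C (n%:Z + 1) u -> u = 0.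
Proof.
move=> [x [xn _ ->]]; rewrite (filt_high _ xn) ?cls0 //.
by rewrite ltrDl.
Qed.

Section StablePage.
Variables (k : nat) (nk : (n + n < k)%N).

Lemma page_d_stable (u : page C k) : page_d u = 0.
Proof.
have [x Zx ->] := page_clsE u; have [z xz] := zigzag_ex Zx.
rewrite (page_dE Zx xz); apply/(cls_page_eq0 (zigzag_Z xz)) => p.
case: (boolP (- n%:Z <= p <= n%:Z)) => pn.
  have [y [_ y2 _ y4]] := xz (p - k%:Z); rewrite subrK in y2 y4.
  (* As p <= n and k > 2n, the bound p - k + 1 is at most -n and constrains no chain. *)
  by exists y; split=> //; apply: filt_low; case/andP: pn; lia.
exists 0; split; [exact: filt0|rewrite linear0; exact: filt0|exact: agree_out].
Qed.

Variable p : int.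

(** The cycles of F^p modulo those homologous to a chain of F^(p+1) will present both F^p H /
    F^(p+1) H and column p of a late page. *)
Definition filt_cycle (x : chains C) := filt p x /\ cycles (dtot C) x.
Lemma filt_cycle0 : filt_cycle 0.
Proof. by split; [exact: filt0|exact: submod0]. Qed.
Lemma filt_cycleZD a x y :
  filt_cycle x -> filt_cycle y -> filt_cycle (a *: x + y).
Proof. by move=> [xp dx] [yp dy]; split; [exact: filtZD|exact: submodZD]. Qed.
Definition filt_cycles : submod (chains C) := Submod filt_cycle0 filt_cycleZD.

Definition filt_boundary (x : chains C) :=
  exists w, filt (p + 1) (x - dtot C w).
Lemma filt_boundary0 : filt_boundary 0.
Proof. by exists 0; rewrite linear0 subr0; exact: filt0. Qed.
Lemma filt_boundaryZD a x y :
  filt_boundary x -> filt_boundary y -> filt_boundary (a *: x + y).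
Proof.
move=> [w xw] [w' yw]; exists (a *: w + w').
by rewrite linearP opprD addrACA -scalerBr; exact: filtZD.
Qed.
Definition filt_boundaries : submod (chains C) :=
  Submod filt_boundary0 filt_boundaryZD.

Lemma gr_H_iso : lin_iso (subquo filt_cycles filt_boundaries)
  (subquo (H_filt C p) (H_filt C (p + 1))).
Proof.
pose g x := cls (H_filt C p) (H_filt C (p + 1)) (Htot x).
have Hp x : filt_cycles x -> H_filt C p (Htot x) by move=> [xp dx]; exists x.
have Zc x : filt_cycles x -> cycles (dtot C) x by case.
have [||u|F Fb _] := @subquo_iso _ (subquo (H_filt C p) (H_filt C (p + 1)))
  filt_cycles filt_boundaries g.
- move=> a x y Zx Zy; rewrite -clsZD; [|exact: Hp..].
  by congr cls; rewrite clsZD //; exact: Zc.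
- move=> x Zx; have dx := Zc x Zx.
  rewrite -[X in _ = X]cls0 (clsP _ (Hp _ Zx) (submod0 _)) subr0.
  split=> [[x' [x'p dx' /(clsP _ dx dx')[w xw]]]|[w xw]].
    by exists w; rewrite -xw subKr.
  have dxw : cycles (dtot C) (x - dtot C w) by exact: dtot_subr_boundary.
  exists (x - dtot C w); split=> //; apply/(clsP _ dx dxw); exists w.
  by rewrite subKr.
- have [x [xp dx xE]] := repP u; exists x => //.
  by rewrite /g -xE repK.
by exists F.
Qed.

Lemma filt_cycle_col (x : chains C) : filt_cycles x -> page_Z C k (column p x).
Proof.
move=> [xp dx] q; have [->|qp] := eqVneq q p.
  exists x; rewrite dx; split=> //; first exact: filt0.
  by move=> i vi; rewrite ffunE vi eqxx.
exists 0; rewrite linear0; split; [exact: filt0..|].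
by move=> i vi; rewrite !ffunE vi (negPf qp).
Qed.

(** If [x - dtot C w] lies in F^(p+1), then [dtot C w] equals [x] up to column p, hence lies in F^p.
    For p in range, the bound that [page_B] puts on [w] itself is void because k > 2n. *)
Lemma filt_boundary_col (x : chains C) :
  filt_cycles x -> (page_B C k (column p x) <-> filt_boundaries x).
Proof.
move=> [xp dx]; split=> [Bx|[w xw] q].
  have [w [_ w2 w3]] := Bx p; exists w => i.
  rewrite ltzD1 le_eqVlt chainsB => /predU1P[vi|vi].
    by rewrite w3 // ffunE vi eqxx subrr.
  by rewrite xp // w2 // subrr.
have [->|qp] := eqVneq q p; last first.
  exists 0; rewrite linear0; split; [exact: filt0..|].
  by move=> i vi; rewrite !ffunE vi (negPf qp).
have wx i : v i <= p -> dtot C w i = x i.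
  by move=> vi; apply/eqP; rewrite eq_sym -subr_eq0 -chainsB xw // ltzD1.
case: (boolP (- n%:Z <= p <= n%:Z)) => pn.
  exists w; split.
  - by apply: filt_low; case/andP: pn; lia.
  - by move=> i vi; rewrite wx ?xp // ltW.
  - by move=> i vi; rewrite wx ?vi // ffunE vi eqxx.
exists 0; rewrite linear0; split; [exact: filt0..|exact: agree_out].
Qed.

Lemma gr_page_iso : lin_iso (subquo filt_cycles filt_boundaries)
  (subquo (page_col C k p) (zero_submod (page C k))).
Proof.
pose cl := cls (page_Z C k) (page_B C k).
pose g x := cls (page_col C k p) (zero_submod (page C k)) (cl (column p x)).
have Cp x : filt_cycles x -> page_col C k p (cl (column p x)).
  move=> Zx; exists (column p x); split=> //; first exact: filt_cycle_col.
  by move=> i vi; rewrite ffunE (negPf vi).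
have [||u|F Fb _] := @subquo_iso _ (subquo (page_col C k p) (zero_submod _))
  filt_cycles filt_boundaries g.
- move=> a x y Zx Zy; rewrite -clsZD; [|exact: Cp..].
  rewrite /g /cl -clsZD; [|exact: filt_cycle_col..].
  congr (cls _ _ (cls _ _ _)); apply/ffunP => i; rewrite !ffunE.
  by case: eqP => // _; rewrite scaler0 addr0.
- move=> x Zx; rewrite -[X in _ = X]cls0 (clsP _ (Cp _ Zx) (submod0 _)) subr0.
  by rewrite -filt_boundary_col // -cls_page_eq0 //; exact: filt_cycle_col.
- have [x [Zx xc xE]] := repP u.
  have [y Zy yx] : exists2 y, filt_cycles y & agree p y x.
    case: (boolP (- n%:Z <= p <= n%:Z)) => pn.
      (* Here p + k > n, so F^(p+k) is zero and the lift [y] is a genuine cycle. *)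
      have [y [y1 y2 y3]] := Zx p; exists y => //; split=> //.
      by apply: (filt_high _ y2); case/andP: pn; lia.
    by exists 0; [exact: filt_cycle0|exact: agree_out].
  exists y => //; rewrite /g /cl -[RHS]repK xE; congr (cls _ _ (cls _ _ _)).
  apply/ffunP => i; rewrite ffunE; case: eqVneq => vi; first exact: yx.
  by rewrite xc.
by exists F.
Qed.

End StablePage.

End Convergence.

Lemma bicomplex_converges (C : bicomplex) (M : lmodType rat) :
  lin_iso (H_tot C) M -> converges_to C M.
Proof.
move=> HM; have [n nv] := gr_v_bounded C; split=> //.
  exists (- n%:Z), (n%:Z + 1); split.
    exact: H_filt_low.
  exact: H_filt_high.
exists (n + n).+1 => k nk; split=> [u|p]; first exact: page_d_stable nk u.
exact: lin_iso_trans (lin_iso_sym (gr_page_iso nv nk p)) (gr_H_iso C p).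
Qed.

(** * The reduced edge ring of a knot diagram as a polynomial ring *)

Lemma cyclic_potential {T : finType} {V : zmodType} (s : T -> T) (h : T -> V) :
    (forall x y, fconnect s x y) -> \sum_x h x = 0 ->
  exists f : T -> V, forall x, f (s x) = f x + h x.
Proof.
move=> s_conn h0; have [x0 _|T0] := pickP T; last first.
  by exists (fun=> 0) => x; have := T0 x.
have s_inj : injective s.
  (* Iterating [s] leads from [s y] back to [y], so [s] is onto, hence injective as [T] is
     finite. *)
  have s_surj y : exists x, s x == y.
    have /iter_findex E := s_conn (s y) y.
    by exists (iter (findex s (s y) y) s y); rewrite -iterS iterSr E.
  have [g gK] := choice s_surj.
  by apply: (can_inj (g := g)); apply: canF_sym => y; exact/eqP.
(* The potential is the partial sum of [h] along the single cycle from [x0]; it closes up because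
   the full sum vanishes. *)
pose F n := \sum_(k < n) h (iter k s x0).
have F0 : F (order s x0) = 0.
  rewrite -[RHS]h0 /F.
  have -> : \sum_x h x = \sum_(x in orbit s x0) h x.
    by apply: eq_bigl => x; rewrite -fconnect_orbit s_conn.
  rewrite -big_uniq ?orbit_uniq //= /orbit.
  rewrite (big_nth x0) size_traject big_mkord.
  by apply: eq_bigr => i _; rewrite nth_traject.
exists (fun x => F (findex s x0 x)) => x; set n := findex s x0 x.
have xE : x = iter n s x0 by rewrite iter_findex.
have n_max : (n < order s x0)%N by exact: findex_max.
have -> : F n + h x = F n.+1 by rewrite /F big_ord_recr /= -xE.
rewrite [in LHS]xE -iterS; move: n_max; rewrite leq_eqVlt => /predU1P[->|n_max].
  by rewrite iter_order // findex0 F0 /F big_ord0.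
by rewrite findex_iter.
Qed.

Section ReducedRing.
Set Implicit Arguments.
Unset Strict Implicit.
Variable D : diagram.

Lemma edge_head_cases e :
  [\/ exists m, @mark_in D m = e, exists c, @in_i D c = e
    | exists c, @in_j D c = e].
Proof.
have := perm_mem (edge_head D) e; rewrite mem_enum !mem_cat.
by case/or3P=> /codomP[y ->];
  [constructor 1|constructor 2|constructor 3]; exists y.
Qed.

Lemma edge_head_uniq :
  [/\ [/\ injective (@mark_in D), injective (@in_i D) & injective (@in_j D)],
      forall c c', in_i c != in_j c' :> edge D &
      forall m c,
        mark_in m != in_i c :> edge D /\ mark_in m != in_j c :> edge D].
Proof.
have := perm_uniq (edge_head D); rewrite enum_uniq !cat_uniq.
case/and3P=> /injectiveP im hm /and3P[/injectiveP ii hj /injectiveP ij].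
split=> //.
- move=> c c'; apply: contraNneq hj => cc'; apply/hasP; exists (in_j c').
    exact: codom_f.
  by rewrite -cc'; exact: codom_f.
- move=> m c; split; apply: contraNneq hm => mc; apply/hasP.
    by exists (in_i c); [rewrite mem_cat codom_f|rewrite -mc codom_f].
  by exists (in_j c); [rewrite mem_cat codom_f orbT|rewrite -mc codom_f].
Qed.

Lemma strandP (e e' : edge D) : reflect
  [\/ exists2 m, mark_in m = e & mark_out m = e',
      exists2 c, in_j c = e & out_k c = e' |
      exists2 c, in_i c = e & out_l c = e'] (strand e e').
Proof.
apply: (iffP or3P) => -[].
- by case/existsP=> m /andP[/eqP ? /eqP ?]; constructor 1; exists m.
- by case/existsP=> m /andP[/eqP ? /eqP ?]; constructor 2; exists m.
- by case/existsP=> m /andP[/eqP ? /eqP ?]; constructor 3; exists m.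
- by case=> m <- <-; constructor 1; apply/existsP; exists m; rewrite !eqxx.
- by case=> m <- <-; constructor 2; apply/existsP; exists m; rewrite !eqxx.
- by case=> m <- <-; constructor 3; apply/existsP; exists m; rewrite !eqxx.
Qed.

Lemma strand_total e : exists e', @strand D e e'.
Proof.
have [[m]|[c]|[c]] := edge_head_cases e => eE.
- by exists (mark_out m); apply/strandP; constructor 1; exists m.
- by exists (out_l c); apply/strandP; constructor 3; exists c.
- by exists (out_k c); apply/strandP; constructor 2; exists c.
Qed.

Lemma strand_functional (e e1 e2 : edge D) :
  strand e e1 -> strand e e2 -> e1 = e2.
Proof.
have [[im ii ij] iNj mN] := edge_head_uniq.
move=> /strandP[] [x xe <-] /strandP[] [y ye <-];
  have xy := etrans xe (esym ye).
- by rewrite (im _ _ xy).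
- by have [_] := mN x y; rewrite xy eqxx.
- by have [] := mN x y; rewrite xy eqxx.
- by have [_] := mN y x; rewrite xy eqxx.
- by rewrite (ij _ _ xy).
- by have := iNj y x; rewrite xy eqxx.
- by have [] := mN y x; rewrite xy eqxx.
- by have := iNj x y; rewrite xy eqxx.
- by rewrite (ii _ _ xy).
Qed.

(* Each crossing is passed twice along the knot, with opposite increments, so
   that the total increment is zero. *)
Lemma knot_potential (V : zmodType) (w : crossing D -> V) : is_knot D ->
  exists f : edge D -> V,
    [/\ forall m, f (mark_out m) = f (mark_in m),
        forall c, f (out_l c) = f (in_i c) + w c &
        forall c, f (in_j c) = f (out_k c) + w c].
Proof.
move=> [_ conn]; have [[im ii ij] iNj mN] := edge_head_uniq.
have [s sP] := choice strand_total.
pose h e := \sum_(c | in_i c == e) w c - \sum_(c | in_j c == e) w c.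
have hi c : h (in_i c) = w c.
  rewrite /h (big_pred1 c) => [|c' /=]; last by rewrite (inj_eq ii).
  by rewrite big1 ?subr0 // => c' /eqP jc; have := iNj c c'; rewrite jc eqxx.
have hj c : h (in_j c) = - w c.
  rewrite /h [X in _ - X](big_pred1 c) => [|c' /=]; last by rewrite (inj_eq ij).
  by rewrite big1 ?sub0r // => c' /eqP ic; have := iNj c' c; rewrite ic eqxx.
have hm m : h (mark_in m) = 0.
  rewrite /h !big1 ?subr0 // => c /eqP mc;
    by have [] := mN m c; rewrite mc eqxx.
have strand_s e e' : strand e e' = (s e == e').
  by apply/idP/eqP=> [|<-]; [exact: strand_functional|exact: sP].
have [||f fE] := @cyclic_potential _ V s h.
- by move=> x y; rewrite -(eq_connect strand_s); exact: conn.
- have sumw (g : crossing D -> edge D) :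
      \sum_e \sum_(c | g c == e) w c = \sum_c w c.
    by rewrite [RHS](partition_big g xpredT).
  by rewrite sumrB !sumw subrr.
have fs e e' : strand e e' -> f e' = f e + h e.
  by rewrite strand_s => /eqP <-.
exists f; split=> [m|c|c].
- rewrite (fs (mark_in m)) ?hm ?addr0 //.
  by apply/strandP; constructor 1; exists m.
- by rewrite (fs (in_i c)) ?hi //; apply/strandP; constructor 3; exists c.
- rewrite (fs (in_j c) (out_k c)) ?hj ?subrK //.
  by apply/strandP; constructor 2; exists c.
Qed.

Lemma edge_pi_rho (v : vertex D) : edge_pi (rho v) = 0.
Proof.
apply/eqP; rewrite -(rmorph0 (@edge_pi D)).
rewrite -(Quotient.idealrBE (rho_ideal (D := D))) subr0.
apply/asboolP; exists (fun v' => (v' == v)%:R).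
rewrite (bigD1 v) //= eqxx mul1r big1 ?addr0 // => v' /negPf ->.
by rewrite mul0r.
Qed.

Lemma edge_ring_eval (S : comAlgType rat) (f : edge D -> S) :
    (forall m, f (mark_out m) = f (mark_in m)) ->
    (forall c, f (out_k c) + f (out_l c) = f (in_i c) + f (in_j c)) ->
  exists psi : {rmorphism edge_ring D -> S},
    forall e, psi (edge_pi (Xe e)) = f e.
Proof.
move=> fm fc.
pose g : {rmorphism edge_poly D -> S} :=
  mmap (in_alg S) (fun i => f (enum_val i)).
have gX e : g (Xe e) = f e by rewrite /g /= /Xe mmapX mmap1U enum_rankK.
have g_rho p : p \in rho_ideal (D := D) -> g p = 0.
  move=> /asboolP[c ->]; rewrite rmorph_sum big1 // => v _; rewrite rmorphM.
  suff -> : g (rho v) = 0 by rewrite mulr0.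
  case: v => [m|x]; rewrite /rho rmorphB ?rmorphD /= !gX.
    by rewrite fm subrr.
  by rewrite fc subrr.
pose psi (x : edge_ring D) : S := g (repr x).
have psiE p : psi (edge_pi p) = g p.
  apply/eqP; rewrite -subr_eq0 -rmorphB; apply/eqP/g_rho.
  by rewrite Quotient.idealrBE reprK.
have edge_piK x : edge_pi (repr x) = x :> edge_ring D by exact: reprK.
have psiB : zmod_morphism psi.
  by move=> x y; rewrite -[x]edge_piK -[y]edge_piK -rmorphB !psiE rmorphB.
have psiM : monoid_morphism psi.
  split; first by rewrite -[1](rmorph1 (@edge_pi D)) psiE rmorph1.
  by move=> x y; rewrite -[x]edge_piK -[y]edge_piK -rmorphM !psiE rmorphM.
pose psiL : {rmorphism edge_ring D -> S} := HB.pack psi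
  (GRing.isZmodMorphism.Build _ _ psi psiB)
  (GRing.isMonoidMorphism.Build _ _ psi psiM).
by exists psiL => e; rewrite /= psiE gX.
Qed.

Definition crossing_var (c : crossing D) : reduced_ring D :=
  Xdiff (in_j c) (out_k c).

(** The potential with increments [w] respects every [rho], so it evaluates the edge ring, and
    [crossing_var c] goes to its increment at c. As [w] is arbitrary, the crossing variables are
    independent. *)
Lemma reduced_ring_eval (S : comAlgType rat) (w : crossing D -> S) :
    is_knot D ->
  exists psi : {rmorphism reduced_ring D -> S},
    forall c, psi (crossing_var c) = w c.
Proof.
move=> /(knot_potential w)[f [fm fi fj]].
have [|psi psiE] := edge_ring_eval fm.
  by move=> c; rewrite fi fj [X in X = _]addrC addrAC addrA.
exists (psi \o (\val : reduced_ring D -> edge_ring D) : {rmorphism _ -> _}).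
move=> c.
by rewrite /= !rmorphB /= !psiE fj addrC addKr.
Qed.

(** The minimality in [in_reduced] is applied to the image in [edge_ring] of the elements satisfying
    [Q]. *)
Lemma reduced_ring_ind (Q : reduced_ring D -> Prop) :
    Q 1 -> (forall a x y, Q x -> Q y -> Q (a *: x + y)) ->
    (forall x y, Q x -> Q y -> Q (x * y)) ->
    (forall e e', Q (Xdiff e e')) ->
  forall x, Q x.
Proof.
move=> Q1 QZD QM QX x.
pose S : {pred edge_ring D} :=
  fun y => `[< exists2 x, reduced_val x = y & Q x >].
have S_closed : subalg_closed S.
  split; first by apply/asboolP; exists 1.
  - move=> a _ _ /asboolP[y1 <- Q1'] /asboolP[y2 <- Q2]; apply/asboolP.
    by exists (a *: y1 + y2); [|exact: QZD].
  - move=> _ _ /asboolP[y1 <- Q1'] /asboolP[y2 <- Q2]; apply/asboolP.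
    by exists (y1 * y2); [|exact: QM].
have SX e e' : edge_pi (Xe e - Xe e') \in S.
  by apply/asboolP; exists (Xdiff e e').
have /asboolP xS := reduced_valP x.
by have /asboolP[y yx Qy] := xS S S_closed SX; rewrite -(val_inj yx).
Qed.

(** Along the knot from [e] to [e'] the difference telescopes into terms that are 0 at a mark and
    plus or minus a crossing variable at a crossing. *)
Lemma knot_ring_ind (Q : reduced_ring D -> Prop) : is_knot D ->
    Q 1 -> (forall a x y, Q x -> Q y -> Q (a *: x + y)) ->
    (forall x y, Q x -> Q y -> Q (x * y)) ->
    (forall c, Q (crossing_var c)) ->
  forall x, Q x.
Proof.
move=> [_ conn] Q1 QZD QM Qz; apply: reduced_ring_ind => // e e'.
have QD x y : Q x -> Q y -> Q (x + y) by move=> /(QZD 1) h /h; rewrite scale1r.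
have Q0 : Q 0 by have := QZD (-1) _ _ Q1 Q1; rewrite scaleN1r addNr.
have QN x : Q x -> Q (- x).
  by move=> /(QZD (-1) _ 0)/(_ Q0); rewrite scaleN1r addr0.
have XdiffE (e1 e2 e3 : edge D) : Xdiff e1 e3 = Xdiff e1 e2 + Xdiff e2 e3.
  by apply: val_inj => /=; rewrite -rmorphD addrA subrK.
have Qs e1 e2 : strand e1 e2 -> Q (Xdiff e1 e2).
  case/strandP=> -[x <- <-]; last 1 first.
  - rewrite (_ : Xdiff _ _ = - crossing_var x); first exact: QN.
    (* The relation at the crossing makes the difference from i to l the negative of that from j to
       k. *)
    have XE : Xe (in_i x) - Xe (out_l x)
        = - (Xe (in_j x) - Xe (out_k x)) - rho (inr x) by rewrite /rho; ring.
    apply: val_inj; rewrite /= XE rmorphB rmorphN.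
    by rewrite [X in _ - X]edge_pi_rho subr0.
  - rewrite (_ : Xdiff _ _ = 0) //; apply: val_inj => /=.
    rewrite -opprB.
    transitivity (- edge_pi (rho (inl x))); first exact: rmorphN.
    by rewrite edge_pi_rho oppr0.
  - exact: Qz.
have /connectP[p] := conn e e'; elim: p e => [|e1 p IH] e /=.
  move=> _ ->; rewrite (_ : Xdiff e e = 0) //; apply: val_inj.
  by rewrite /= subrr rmorph0.
move=> /andP[ee1 pp] pe; rewrite (XdiffE e e1); apply: QD; first exact: Qs.
exact: IH.
Qed.

End ReducedRing.

(** * The total homology, cancelling one crossing at a time *)

Lemma mul_divide (S : comNzRingType) (z x y x' y' : S) :
  (x + z * y) * (x' + z * y') = x * x' + z * (y * (x' + z * y') + x * y').
Proof. by ring. Qed.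

(** Additive maps between rational vector spaces are automatically linear, so plain ring morphisms
    suffice. *)
Lemma rat_rmorphismZ (A B : algType rat) (f : {rmorphism A -> B}) a x :
  f (a *: x) = a *: f x.
Proof. exact: (rat_linear (raddfB f)). Qed.

Section TotalHomology.
Set Implicit Arguments.
Unset Strict Implicit.
Variable D : diagram.
Hypothesis D_knot : is_knot D.
Local Notation R := (reduced_ring D).
Local Notation X := (crossing D).
Local Notation P := {mpoly rat[#|crossing D|]}.
Local Notation crossing_var := (@crossing_var D).

Definition trunc_var (T : {set X}) (c : X) : P :=
  if c \in T then 0 else 'X_(enum_rank c).

(* Its kernel is the ideal generated by the [crossing_var c] with c in T. *)
Definition trunc_eval (T : {set X}) : {rmorphism R -> P} :=
  projT1 (cid (reduced_ring_eval (trunc_var T) D_knot)).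

Lemma trunc_evalE T c : trunc_eval T (crossing_var c) = trunc_var T c.
Proof. by rewrite /trunc_eval; case: cid. Qed.

Lemma rmorphism_ext (S : comAlgType rat) (f g : {rmorphism R -> S}) :
  (forall c, f (crossing_var c) = g (crossing_var c)) -> f =1 g.
Proof.
move=> fg; apply: (knot_ring_ind D_knot) => //.
- by rewrite !rmorph1.
- by move=> a x y xE yE; rewrite !rmorphD !rat_rmorphismZ xE yE.
- by move=> x y xE yE; rewrite !rmorphM xE yE.
Qed.

(** Sending each variable back to its crossing variable gives a left inverse, as can be checked on
    generators. *)
Lemma trunc_eval_set0 x : trunc_eval set0 x = 0 -> x = 0.
Proof.
pose g : {rmorphism P -> R} :=
  mmap (in_alg R) (fun i => crossing_var (enum_val i)).
move/(congr1 g); rewrite rmorph0 => <-.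
apply: (rmorphism_ext (f := idfun) (g := g \o trunc_eval set0)) => c.
rewrite /= trunc_evalE /trunc_var inE mmapX mmap1U.
by rewrite enum_rankK.
Qed.

Lemma trunc_eval_le (T T' : {set X}) x :
  T \subset T' -> trunc_eval T x = 0 -> trunc_eval T' x = 0.
Proof.
move=> TT'; pose g : {rmorphism P -> P} :=
  mmap (in_alg P) (fun i => trunc_var T' (enum_val i)).
move/(congr1 g); rewrite rmorph0 => <-.
apply: (rmorphism_ext (f := trunc_eval T') (g := g \o trunc_eval T)) => c.
rewrite /= !trunc_evalE [trunc_var T c]/trunc_var; case: ifP => [cT|_].
  by rewrite rmorph0 /trunc_var (subsetP TT').
by rewrite mmapX mmap1U enum_rankK.
Qed.

(** [P] is an integral domain and the image of [crossing_var c] is a variable, nonzero since it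
    takes the value 1 somewhere. *)
Lemma trunc_eval_regular (T : {set X}) c x :
  c \notin T -> trunc_eval T (crossing_var c * x) = 0 -> trunc_eval T x = 0.
Proof.
move=> cT /eqP; rewrite rmorphM trunc_evalE /trunc_var (negPf cT) mulf_eq0.
case/orP=> /eqP // /(congr1 (meval (fun=> 1))); rewrite mevalXU rmorph0 => /eqP.
by rewrite oner_eq0.
Qed.

(** Every [x] is [x' + crossing_var c * y] with [x'] free of the variable of [c], encoded as
    agreement of its truncations at [T] and [c |: T]. If [x] dies at [c |: T], then [x'] dies
    already at [T]. *)
Lemma trunc_eval_divide (T : {set X}) c x :
    c \notin T -> trunc_eval (c |: T) x = 0 ->
  exists y, trunc_eval T (crossing_var c * y) = trunc_eval T x.
Proof.
move=> cT; suff [x' [y [-> x'E]]] : exists x' y, x = x' + crossing_var c * y /\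
    trunc_eval T x' = trunc_eval (c |: T) x'.
  rewrite rmorphD rmorphM trunc_evalE /trunc_var setU11 mul0r addr0 -x'E => x'0.
  by exists y; rewrite [RHS]rmorphD x'0 add0r.
move: x; apply: (knot_ring_ind D_knot).
- by exists 1, 0; rewrite mulr0 addr0 !rmorph1.
- move=> a _ _ [x [y [-> xE]]] [x' [y' [-> xE']]].
  exists (a *: x + x'), (a *: y + y').
  by rewrite !rmorphD !rat_rmorphismZ xE xE' mulrDr -scalerAr scalerDr addrACA.
- move=> _ _ [x [y [-> xE]]] [x' [y' [-> xE']]].
  exists (x * x'), (y * (x' + crossing_var c * y') + x * y').
  by rewrite mul_divide !rmorphM xE xE'.
- move=> c'; have [->|c'c] := eqVneq c' c.
    by exists 0, 1; rewrite mulr1 add0r !rmorph0.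
  exists (crossing_var c'), 0; rewrite mulr0 addr0 !trunc_evalE.
  by rewrite /trunc_var in_setU1 (negPf c'c).
Qed.

(* The corner that survives is A' at a positive crossing and B' at a negative
   one. *)
Definition top_set : {set bool * X} := [set a | a.1 || ~~ positive a.2].

Definition top_on (T : {set X}) (s : {set bool * X}) : Prop :=
  forall a, a.2 \in T -> (a \in s) = (a \in top_set).

(* The kernel of the projection of C_r onto the quotient complex where the
   crossings of T are already cancelled. *)
Definition top_ideal (T : {set X}) (x : chains (C_r D)) : Prop :=
  forall s, top_on T s -> trunc_eval T (x s) = 0.

Local Notation kap := (@crossing_map D).

Lemma local_dvertE (c : X) h :
  local_dvert c h = if h == ~~ positive c then crossing_var c else 1.
Proof. by rewrite /local_dvert /crossing_var; case: (positive c); case: h. Qed.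

(** Every arrow into the surviving corner is a multiple of z_c: d_v is z_c there, and at a negative
    crossing the quadratic d_+ into B' has the factor X_k - X_j = -z_c. *)
Lemma crossing_map_top T s a :
  top_on T s -> a \in s -> a.2 \in T -> trunc_eval T (kap a s) = 0.
Proof.
have zT c : c \in T -> trunc_eval T (crossing_var c) = 0.
  by rewrite trunc_evalE /trunc_var => ->.
case: a => [[] c] sT sa /= cT; rewrite /crossing_map /= /hbit /vbit.
  by rewrite local_dvertE (sT (false, c)) // inE /= eqxx zT.
rewrite (sT (true, c)) // inE /= /local_dplus.
have := sT (false, c) cT; rewrite sa inE /= => /esym/negPf ->.
have -> : Xdiff (out_k c) (in_j c) = - crossing_var c.
  by apply: val_inj; rewrite /= -opprB rmorphN.
by rewrite mulrN opprK rmorphM zT // mulr0.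
Qed.

Lemma dtot_cubeE (x : chains (C_r D)) s :
  dtot (C_r D) x s = \sum_(a in s) cube_sign a s *: (kap a s * x (s :\ a)).
Proof.
rewrite chainsD [d_plus _ _ _]ffunE [d_vert _ _ _]ffunE addrC.
by rewrite [RHS](bigID (fun a => a.1)) /=.
Qed.

(* The component of d_v from [s :\ v] to [s] is 1 or the variable of c, according
   to whether [s] leaves or keeps the surviving corner at c; dividing [x s] by it
   gives the value of [y] at [s :\ v]. *)
Lemma top_ideal_step (T : {set X}) c (x : chains (C_r D)) : c \notin T ->
    top_ideal (c |: T) x -> dtot (C_r D) x = 0 ->
  exists2 y, top_ideal (c |: T) y & top_ideal T (x - dtot (C_r D) y).
Proof.
move=> cT Kx dx; pose v := (true, c).
have topU s (a : bool * X) : a.2 \notin T -> top_on T s -> top_on T (a |: s).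
  move=> aT sT b bT; rewrite in_setU1 -sT //.
  by case: eqVneq => // ba; move: aT; rewrite -ba bT.
have topD s (a : bool * X) : a.2 \notin T -> top_on T s -> top_on T (s :\ a).
  move=> aT sT b bT; rewrite in_setD1 -sT //.
  by case: eqVneq => // ba; move: aT; rewrite -ba bT.
have sign2 s (a : bool * X) : cube_sign a s * cube_sign a s = 1.
  by rewrite /cube_sign -expr2 sqrr_sign.
have /choice[y yP] (s : {set bool * X}) : exists y, v \in s -> top_on T s ->
    trunc_eval T (kap v s * y) = trunc_eval T (x s).
  case: (boolP (v \in s)) => vs; last by exists 0.
  rewrite /crossing_map /= local_dvertE; case: eqP => h; last first.
    by exists (x s); rewrite mul1r.
  case: (pselect (top_on T s)) => sT; last by exists 0.
  have [|y yE] := @trunc_eval_divide T c (x s) cT; last by exists y.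
  apply: Kx => -[[] c'] /=; rewrite in_setU1 => /predU1P[->|c'T].
  - by rewrite [LHS]vs inE.
  - by rewrite (sT (true, c')).
  - by rewrite -[LHS]/(hbit c s) h inE.
  - by rewrite (sT (false, c')).
(* [Y] lives on the sets without [v], so at a set containing [v] only the arrow in direction [v]
   contributes to its differential; the sign is chosen to cancel that of the arrow. *)
pose Y : chains (C_r D) := [ffun s : {set bool * X} =>
  if v \in s then 0 else cube_sign v (v |: s) *: y (v |: s)].
have YE (s : {set bool * X}) : v \in s -> Y s = 0 by rewrite /Y ffunE => ->.
exists Y => [s sT|].
  by rewrite YE ?rmorph0 // (sT v) ?inE //= eqxx.
have dY (s : {set bool * X}) : v \in s -> dtot (C_r D) Y s = kap v s * y s.
  move=> vs; rewrite dtot_cubeE (bigD1 v) //= big1 ?addr0 => [|a /andP[_ av]].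
    rewrite /Y ffunE !inE eqxx setD1K //= -scalerAr scalerA sign2 scale1r //.
  by rewrite YE ?mulr0 ?scaler0 // !inE eq_sym av vs.
set x' := x - _.
have x'v (s : {set bool * X}) :
    v \in s -> top_on T s -> trunc_eval T (x' s) = 0.
  by move=> vs sT; rewrite chainsB dY // rmorphB yP // subrr.
move=> s sT; case: (boolP (v \in s)) => vs; first exact: x'v.
have vsT : top_on T (v |: s) by exact: topU.
have vvs : v \in v |: s by exact: setU11.
(* In this coefficient only the arrow from [s] survives: directions over [T] are killed by
   [crossing_map_top], and the others start at sets containing [v], where [x'] already dies. The map
   from [s] is 1 or z_c, which is regular modulo [T]. *)
have : trunc_eval T (dtot (C_r D) x' (v |: s)) = 0.
  have -> : dtot (C_r D) x' = 0 by exact: dtot_subr_boundary.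
  by rewrite ffunE rmorph0.
rewrite dtot_cubeE (bigD1 v) //= setU1K // rmorphD rmorph_sum big1 ?addr0.
  rewrite rat_rmorphismZ => /(congr1 (GRing.scale (cube_sign v (v |: s)))).
  rewrite scalerA sign2 scale1r scaler0 /crossing_map /= local_dvertE.
  by case: eqP => _; [exact: trunc_eval_regular|rewrite mul1r].
move=> a /andP[avs av]; rewrite rat_rmorphismZ rmorphM.
case: (boolP (a.2 \in T)) => aT.
  by rewrite (crossing_map_top vsT avs aT) mul0r scaler0.
rewrite x'v ?mulr0 ?scaler0 //; last exact: topD.
by rewrite in_setD1 eq_sym av.
Qed.

(** Subtracting a boundary moves a cycle into the ideal of a set with one crossing less, which is
    contained in that of [T]. For the empty set the ideal is zero, as [trunc_eval set0] is
    injective. *)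
Lemma top_ideal_acyclic T (x : chains (C_r D)) :
    top_ideal T x -> dtot (C_r D) x = 0 ->
  exists2 y, top_ideal T y & x = dtot (C_r D) y.
Proof.
elim: {T}#|T| {-2}T (erefl #|T|) x => [|n IH] T Tn x Kx dx.
  exists 0; first by move=> s _; rewrite ffunE rmorph0.
  rewrite linear0; apply/ffunP => s; rewrite ffunE.
  move/eqP: Tn; rewrite cards_eq0 => /eqP T0.
  by apply: trunc_eval_set0; rewrite -T0; apply: Kx => a; rewrite T0 inE.
have [c cT] : exists c, c \in T by apply/set0Pn; rewrite -card_gt0 Tn.
pose T' := T :\ c; have TE : c |: T' = T by exact: setD1K.
have cT' : c \notin T' by rewrite !inE eqxx.
have [|y Ky Kxy] := top_ideal_step cT' _ dx; first by rewrite TE.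
rewrite TE in Ky.
have dxy := dtot_subr_boundary y dx.
have T'n : #|T'| = n by apply: succn_inj; rewrite -Tn (cardsD1 c T) cT.
have [y' Ky' y'E] := IH T' T'n _ Kxy dxy.
exists (y + y').
  move=> s sT; rewrite chainsD rmorphD Ky // add0r.
  rewrite (trunc_eval_le (T := T')) ?subsetDl //; apply: Ky' => a aT'.
  by apply: sT; move: aT'; rewrite inE => /andP[].
transitivity (dtot (C_r D) y + dtot (C_r D) y'); last by rewrite linearD.
by rewrite -y'E addrC subrK.
Qed.

(** The isomorphism evaluates the coefficient at [top_set] with all crossing variables set to 0. Its
    kernel is [top_ideal setT], which contains all boundaries and is acyclic. *)
Lemma total_homology : lin_iso (H_tot (C_r D)) rat^o.
Proof.
have [e eE] := reduced_ring_eval (S := rat^o) (fun=> 0) D_knot.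
have trunc_setT x : trunc_eval setT x = (e x)%:A.
  pose g : {rmorphism R -> P} := in_alg P \o (e : {rmorphism R -> rat}).
  have := rmorphism_ext (f := trunc_eval setT) (g := g); apply => c.
  by rewrite /g /= trunc_evalE /trunc_var inE eE scale0r.
have e0 x : e x = 0 <-> trunc_eval setT x = 0.
  rewrite trunc_setT; split=> [->|/eqP]; first by rewrite scale0r.
  by rewrite scaler_eq0 oner_eq0 orbF => /eqP.
have top_setT (s : {set bool * X}) : top_on setT s <-> s = top_set.
  by split=> [sT|-> //]; apply/setP => a; rewrite sT ?inE.
have KT x : top_ideal setT x <-> e (x top_set) = 0.
  split=> [Kx|ex s /top_setT ->]; last exact/e0.
  by apply/e0/Kx/top_setT.
have Kd x : e (dtot (C_r D) x top_set) = 0.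
  apply/e0; rewrite dtot_cubeE rmorph_sum big1 // => a sa.
  have top_top : top_on setT top_set by [].
  rewrite rat_rmorphismZ rmorphM (crossing_map_top top_top sa) ?inE //.
  by rewrite mul0r scaler0.
pose g (x : chains (C_r D)) : rat^o := e (x top_set).
have [||w|F Fb _] := @subquo_iso _ rat^o
    (cycles (dtot (C_r D))) (boundaries (dtot (C_r D))) g; last by exists F.
- by move=> a x y _ _; rewrite /g !ffunE rmorphD rat_rmorphismZ.
- move=> x dx; split=> [/KT Kx|[y ->]]; last exact: Kd.
  by have [y _ ->] := top_ideal_acyclic Kx dx; exists y.
(* This chain has the value [w] but need not be a cycle; its differential is a cycle in the acyclic
   ideal, so [x] can be corrected by some [y] there without changing the value. *)
pose x : chains (C_r D) := [ffun s => if s == top_set then w%:A else 0].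
have [|y /KT Ky yE] := @top_ideal_acyclic setT (dtot (C_r D) x) _ (dtotK _).
  by apply/KT; exact: Kd.
exists (x - y).
  transitivity (dtot (C_r D) x - dtot (C_r D) y); first exact: linearB.
  by rewrite yE subrr.
rewrite /g chainsB rmorphB Ky subr0 ffunE eqxx rat_rmorphismZ rmorph1.
exact: mulr1.
Qed.

End TotalHomology.

(** * The effect of d_+ and d_v on the columns of [C_r] *)

Section ColumnGrading.
Set Implicit Arguments.
Unset Strict Implicit.
Variable D : diagram.

Lemma gr_v_dplus (a : bool * crossing D) (s : {set bool * crossing D}) :
  ~~ a.1 -> gr_v (b := C_r D) (s :\ a) = gr_v (b := C_r D) s.
Proof.
case: a => [[] c] //= _; apply: eq_bigr => c' _.
by rewrite /vbit in_setD1.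
Qed.

Lemma gr_v_dvert (a : bool * crossing D) (s : {set bool * crossing D}) :
  a.1 -> a \in s -> gr_v (b := C_r D) s = gr_v (b := C_r D) (s :\ a) + 1.
Proof.
case: a => [[] c] //= _ sc; rewrite (bigD1 c) // [in RHS](bigD1 c) //= addrAC.
congr (_ + _); last first.
  apply: eq_bigr => c' c'c.
  by rewrite /vbit in_setD1 xpair_eqE (negPf c'c) andbF.
by rewrite /vbit in_setD1 eqxx sc /local_v; case: positive.
Qed.

Lemma dp_agree_C_r p (x y : chains (C_r D)) :
  agree p x y -> agree p (dp (C_r D) x) (dp (C_r D) y).
Proof.
move=> xy s sp; rewrite [LHS]ffunE [RHS]ffunE; apply: eq_bigr => a /andP[_ a1].
by rewrite xy // gr_v_dplus.
Qed.

Lemma dv_agree_C_r p (x y : chains (C_r D)) :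
  agree p x y -> agree (p + 1) (dv (C_r D) x) (dv (C_r D) y).
Proof.
move=> xy s sp; rewrite [LHS]ffunE [RHS]ffunE; apply: eq_bigr => a /andP[sa a1].
by rewrite xy //; apply: (addIr 1); rewrite -gr_v_dvert.
Qed.

End ColumnGrading.

Theorem theorem3 (D : diagram) (b : nat)
    (D_braid : closed_braid D b) (D_knot : is_knot D) :
  [/\ (forall k : nat,
        (forall u : E_minus1 D b k, d_minus1 D b k (d_minus1 D b k u) = 0) /\
        giso (homology (d_minus1 D b k)) (E_minus1 D b k.+1)),
      dgiso (d_minus1 D b 0)
        (dp (C_r D) : KR_shift D b (chains (C_r D)) ->
                      KR_shift D b (chains (C_r D))),
      dgiso (d_minus1 D b 1)
        (d_vert_star (C_r D) : KR_shift D b (H_plus (C_r D)) ->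
                               KR_shift D b (H_plus (C_r D))),
      giso (E_minus1 D b 2) (reduced_HOMFLY D b)
    & converges_to (C_r D) rat^o].
Proof.
split.
- move=> k; split; first exact: page_dK.
  refine (giso_trans (homology_gshift (page_d (C := C_r D) (k := k)) _ _ _) _).
  exact: giso_gshift (homology_page (C_r D) k).
- exact: dgiso_gshift (page0_dgiso (@dp_agree_C_r D) (@dv_agree_C_r D)).
- exact: dgiso_gshift (page1_dgiso (@dp_agree_C_r D) (@dv_agree_C_r D)).
- exact: giso_gshift (page2_giso (@dp_agree_C_r D) (@dv_agree_C_r D)).
- exact/bicomplex_converges/total_homology.
Qed.
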